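(* For the polar equations of motion $\frac{d^2r}{dt^2}=\omega^2r-U'(r)$, $\frac{d^2\theta}{dt^2}=-2\omega v/r$ (with $v=dr/dt$, $\omega=d\theta/dt$) of general central force dynamics, let $$L=\omega r^2,\qquad E=\tfrac12v^2+\tfrac12L^2r^{-2}+U(r)-U(r_{\rm eq}),$$ $$\Theta=\theta-L\int_{r_0}^{r}\frac{\operatorname{sgn}(v)}{\sqrt{2(E+U(r_{\rm eq})-U(s))s^4-L^2s^2}}\,ds,\qquad T=t-\int_{r_0}^{r}\frac{\operatorname{sgn}(v)}{\sqrt{2(E+U(r_{\rm eq})-U(s))-L^2s^{-2}}}\,ds,$$ where $r_0$ is a turning point or an inertial point of the trajectory. Then: (1) $L$ and $E$ are well-defined first integrals for all solutions. ($L$ depends solely on $r,\omega$; $E$ depends solely on $v$ and $U_{\rm eff}(r)$.) (2) $\Theta$ and $T$ are well-defined first integrals for all non-circular solutions. (Apart from the additive terms $\theta$ and $t$, both depend solely on $L$, $E$, $\operatorname{sgn}(v)$ and $U_{\rm eff}(r)$.) (3) $L$, $E$, $\Theta$ are functionally independent constants of motion. (4) Every first integral is a function of $L,E,\Theta,T$, and every constant of motion is a function of $L,E,\Theta$.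
   Context: The mass is $m=1$; $U$ is a smooth radial potential on $r>0$. A first integral is a function $I(t,r,\theta,v,\omega)$ with $dI/dt=0$ along all solutions, i.e. $I_t+vI_r+\omega I_\theta+(\omega^2r-U'(r))I_v-(2\omega v/r)I_\omega=0$. A constant of motion is a first integral that does not involve $t$ explicitly. $r_{\rm eq}$ is a fixed equilibrium point of the potential: a root of $U'(r_{\rm eq})=0$ (possibly $r_{\rm eq}=0$ or $\infty$, with $U(r_{\rm eq})$ finite); thus $U(r_{\rm eq})$ is just a constant. The effective potential is $U_{\rm eff}(r)=\tfrac12L^2r^{-2}+U(r)-U(r_{\rm eq})$. A turning point is a finite radius $r_*$ with $U_{\rm eff}(r_* )=E$ (equivalently $v=0$ there); an inertial point is a finite radius $r^*$ with $U_{\rm eff}'(r^* )=0$, i.e. $(r^* )^3U'(r^* )=L^2$. It is assumed that every non-circular solution considered has at least one turning point or inertial point occurring on its trajectory, and $r_0$ is chosen as such a radius; $r_0=r_0(L,E)$ is a differentiable function of $(L,E)$ (a branch of the roots of the corresponding equation). A solution is circular if $r(t)$ is constant. Since the integrands involve $\operatorname{sgn}(v)$, $\Theta$ and $T$ are piecewise functions on a trajectory: being a first integral means that they are constant on every part of the trajectory on which $v\ne0$ (their constant values may jump at some turning points). Functional independence and ''is a function of'' are understood locally, near points with $v\neq0$. *)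

(* Defs.v *)
From HB Require Import structures.
From mathcomp Require Import all_boot all_order all_algebra.
From mathcomp Require Import all_classical all_reals all_analysis.
Set Implicit Arguments.
Unset Strict Implicit.
Unset Printing Implicit Defensive.
Import Order.TTheory GRing.Theory Num.Theory.
Import numFieldNormedType.Exports.
Local Open Scope ring_scope.
Local Open Scope classical_set_scope.

(* States are tuples (t, r, theta, v, omega), the last four being the
   independent coordinates of the first-order form of the equations. *)
Notation phase R := (R * R * R * R * R)%type.

Section CentralForce.
Context {R : realType}.
Implicit Types (U : R -> R) (ueq L E x : R) (p q : phase R).

Definition time p : R := p.1.1.1.1.
Definition rcoord p : R := p.1.1.1.2.
Definition angle p : R := p.1.1.2.
Definition vel p : R := p.1.2.
Definition angvel p : R := p.2.

Definition phase_space : set (phase R) := [set p | 0 < rcoord p].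

(* U is a total function, but only its values on r > 0 are meaningful. *)
Definition smooth_potential U :=
  forall (n : nat) x, 0 < x -> derivable (derive1n n U) x 1.

(* [equilibrium U req ueq]: req is a root of U', possibly 0 or +oo, where U
   has the finite value ueq.  At 0 and +oo, U' and U are read as limits. *)
Inductive equilibrium U : \bar R -> R -> Prop :=
| equilibrium_interior x of 0 < x & derive1 U x = 0 : equilibrium U x%:E (U x)
| equilibrium_origin ueq of
    derive1 U s @[s --> 0^'+] --> (0 : R) & U s @[s --> 0^'+] --> ueq :
    equilibrium U 0%:E ueq
| equilibrium_infinity ueq of
    derive1 U s @[s --> +oo] --> (0 : R) & U s @[s --> +oo] --> ueq :
    equilibrium U +oo%E ueq.

Definition state (r th : R -> R) (t : R) : phase R :=
  (t, r t, th t, derive1 r t, derive1 th t).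

(* Solutions of r'' = omega^2 r - U'(r), theta'' = - 2 omega v / r on an open
   time interval J, not assumed maximal. *)
Definition solution U (J : set R) (r th : R -> R) :=
  [/\ open J, is_interval J & forall t, J t ->
   [/\ 0 < r t, derivable r t 1, derivable th t 1,
       is_derive t 1 (derive1 r) ((derive1 th t) ^+ 2 * r t - derive1 U (r t))
     & is_derive t 1 (derive1 th) (- 2 * derive1 th t * derive1 r t / r t)]].

Definition circular (J : set R) (r : R -> R) :=
  exists c : R, forall t, J t -> r t = c.

(* dI/dt = 0 along all solutions in D, written out by the chain rule. *)
Definition first_integral_on U (D : set (phase R)) (I : phase R -> R) :=
  forall p, D p -> differentiable I p /\
    'D_((1, 0, 0, 0, 0) : phase R) I p
    + vel p * 'D_((0, 1, 0, 0, 0) : phase R) I p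
    + angvel p * 'D_((0, 0, 1, 0, 0) : phase R) I p
    + ((angvel p) ^+ 2 * rcoord p - derive1 U (rcoord p))
      * 'D_((0, 0, 0, 1, 0) : phase R) I p
    - (2 * angvel p * vel p / rcoord p)
      * 'D_((0, 0, 0, 0, 1) : phase R) I p = 0.

Definition constant_of_motion_on U (D : set (phase R)) (I : phase R -> R) :=
  first_integral_on U D I /\
  forall (t t' r th v w : R), D (t, r, th, v, w) -> D (t', r, th, v, w) ->
    I (t, r, th, v, w) = I (t', r, th, v, w).

Definition functionally_independent_at n (f : 'I_n -> phase R -> R) p :=
  (forall i, differentiable (f i) p) /\
  forall c : 'I_n -> R,
    (forall h : phase R, \sum_(i < n) c i * 'd (f i) p h = 0) ->
    forall i, c i = 0.

Definition locally_function_of (V : normedModType R) (f : phase R -> V)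
    (I : phase R -> R) p :=
  exists F : V -> R,
    \forall q \near p, differentiable F (f q) /\ I q = F (f q).

Definition Ueff U ueq L x : R := 2^-1 * L ^+ 2 * x ^- 2 + U x - ueq.

Definition turning_point U ueq L E x := 0 < x /\ Ueff U ueq L x = E.

Definition inertial_point U ueq L x := 0 < x /\ derive1 (Ueff U ueq L) x = 0.

Definition angmom p : R := angvel p * rcoord p ^+ 2.

Definition energy U ueq p : R :=
  2^-1 * vel p ^+ 2 + 2^-1 * angmom p ^+ 2 * rcoord p ^- 2
  + U (rcoord p) - ueq.

Definition oriented_integral (a b : R) (f : R -> R) : R :=
  if a <= b then \int[lebesgue_measure]_(s in `[a, b]) f s
  else - \int[lebesgue_measure]_(s in `[b, a]) f s.

(* Absolute convergence of [oriented_integral a b f]; f may be singular at an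
   endpoint, as the integrands below are at a turning point. *)
Definition integrable_between (a b : R) (f : R -> R) :=
  lebesgue_measure.-integrable `[Num.min a b, Num.max a b] (EFin \o f).

Definition angle_radicand U ueq L E x : R :=
  2 * (E + ueq - U x) * x ^+ 4 - L ^+ 2 * x ^+ 2.

Definition time_radicand U ueq L E x : R :=
  2 * (E + ueq - U x) - L ^+ 2 * x ^- 2.

Definition angle_integrand U ueq p x : R :=
  Num.sg (vel p) / Num.sqrt (angle_radicand U ueq (angmom p) (energy U ueq p) x).

Definition time_integrand U ueq p x : R :=
  Num.sg (vel p) / Num.sqrt (time_radicand U ueq (angmom p) (energy U ueq p) x).

Definition base_radius U ueq (r0 : R * R -> R) p : R :=
  r0 (angmom p, energy U ueq p).

Definition Theta U ueq (r0 : R * R -> R) p : R :=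
  angle p - angmom p *
    oriented_integral (base_radius U ueq r0 p) (rcoord p)
      (angle_integrand U ueq p).

Definition Tint U ueq (r0 : R * R -> R) p : R :=
  time p -
    oriented_integral (base_radius U ueq r0 p) (rcoord p)
      (time_integrand U ueq p).

(* LE ranges over the open set B of pairs (L, E) on which r0 is defined. *)
Definition radius_branch U ueq (B : set (R * R)) (r0 : R * R -> R) :=
  open B /\ forall LE, B LE -> differentiable r0 LE /\
    (turning_point U ueq LE.1 LE.2 (r0 LE) \/
     inertial_point U ueq LE.1 (r0 LE)).

Definition occurs_on_trajectory U p x :=
  exists (J : set R) (r th : R -> R) (t t' : R),
    [/\ solution U J r th, J t, J t', state r th t = p & r t' = x].

(* The states with v <> 0 whose trajectory (hence not circular) passes through
   the radius r0(L, E). *)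
Definition branch_domain U ueq (B : set (R * R)) (r0 : R * R -> R) :
    set (phase R) :=
  [set p | [/\ vel p != 0, B (angmom p, energy U ueq p)
             & occurs_on_trajectory U p (base_radius U ueq r0 p)]].

End CentralForce.

(* Main.v *)
Require Import Defs.
From HB Require Import structures.
From mathcomp Require Import all_boot all_order all_algebra.
From mathcomp Require Import all_classical all_reals all_analysis measurable_realfun.
From mathcomp Require Import ring lra.
Set Implicit Arguments.
Unset Strict Implicit.
Unset Printing Implicit Defensive.
Import Order.TTheory GRing.Theory Num.Theory.
Import numFieldNormedType.Exports.
Local Open Scope ring_scope.
Local Open Scope classical_set_scope.

(* Along a solution v^2 = 2 (E - Ueff(r)), so a trajectory that touches a zero
   of the right-hand side where Ueff' also vanishes is circular (Gronwall).
   Hence on a non-circular trajectory the radicand is positive between r0 and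
   r, and r0 is either a zero with Ueff'(r0) <> 0 or not a zero at all.

   The integrals defining Theta and T are differentiable in (L, E, r).  Away
   from turning points this is differentiation under the integral sign.  Near a
   turning point, with Y the radicand and V = Ueff', two integrations by parts
   against Y' = - 2 V turn the integrand w Y^(-1/2) into C Y^(3/2), which
   extends by 0 to a C^1 function across the zero of Y.

   The derivatives of Theta and T along the flow then vanish by the chain rule.
   Conversely (L, E, Theta, T, r) are local coordinates in which the flow moves
   only r, so a first integral does not depend on r. *)

(** * Differentials *)

(** The obstacle is the dependence on (L, E) near a turning point: there the E-derivative of
    Y^(-1/2) has order Y^(-3/2), which is not integrable. One integration by parts leaves Y^(1/2),
    whose derivative is still singular; two leave Y^(3/2). Since [Num.sqrt] is 0 on negative reals,
    [Y * Num.sqrt Y] also makes sense beyond the turning point, so the remainder can be integrated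
    from a fixed radius while r0(L, E) moves, and the boundary terms vanish at r0.

    Passing through the radius r0 is not visibly an open condition on states. The trajectory
    therefore only provides sign information on Y and V at one state; that information persists for
    nearby (L, E, r), so the formulas for Theta and T hold on a full neighbourhood and can be
    differentiated.

    Both integrals are integrals of w Y^(-1/2), with w = 1 for T and w = s^(-2) for Theta, because
    the angular radicand is s^4 Y. *)

Lemma differentiable_approx (R : realType) (V W : normedModType R)
    (f : V -> W) (df : {linear V -> W}) (x : V) :
  continuous df ->
  (forall e : R, 0 < e ->
    \forall y \near x, `|f y - f x - df (y - x)| <= e * `|y - x|) ->
  differentiable f x /\ 'd f x = df :> (V -> W).
Proof.
move=> cdf fx.
have fE : f \o shift x = cst (f x) + df +o_ 0 id.
  apply/eqaddoP => e e0.
  have := fx e e0; rewrite (near_shift 0 x) => fxe.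
  apply: filterS fxe => y /=; rewrite /= subr0 addrK => H.
  by rewrite opprD addrA.
have dE := diff_unique cdf fE; split=> //.
by apply/diff_locallyP; rewrite dE.
Qed.

Lemma is_derive_pair (R : realType) (V W : normedModType R)
    (f : R -> V) (g : R -> W) (t : R) (df : V) (dg : W) :
  is_derive t 1 f df -> is_derive t 1 g dg ->
  is_derive t 1 (fun s => (f s, g s)) (df, dg).
Proof.
move=> [/derivable1_diffP fd fE] [/derivable1_diffP gd gE].
have fgd := differentiable_pair fd gd.
apply: DeriveDef; first exact/derivable1_diffP.
by rewrite deriveE// diff_pair// -!deriveE// fE gE.
Qed.

Lemma is_derive_diff_comp (R : realType) (V W : normedModType R)
    (G : V -> W) (g : R -> V) (t : R) (v : V) :
  is_derive t 1 g v -> differentiable G (g t) ->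
  is_derive t 1 (fun s => G (g s)) ('d G (g t) v).
Proof.
move=> [/derivable1_diffP gd gE] Gd.
have cd : differentiable (G \o g) t by exact: differentiable_comp.
apply: DeriveDef; first exact/derivable1_diffP.
by rewrite deriveE// diff_comp//= -gE deriveE.
Qed.

(** * Oriented integrals *)

Lemma within_continuous_cvg (R : realType) (f : R -> R) (a b : R) (u : nat -> R) (l : R) :
  {within `[a, b], continuous f} -> (forall n, a <= u n <= b) -> a <= l <= b ->
  u @ \oo --> l -> f (u n) @[n --> \oo] --> f l.
Proof.
move=> cf uab lab ul.
have lI : `[a, b]%classic l by rewrite /= in_itv.
have fl : f x @[x --> within `[a, b] (nbhs l)] --> f l.
  by have /subspace_continuousP := cf; apply.
move=> A /fl wA.
have nA : \forall n \near \oo, `[a, b]%classic (u n) -> A (f (u n)) := ul _ wA.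
change (\forall n \near \oo, A (f (u n))).
apply: filterS nA => n; apply.
by have := uab n; rewrite /= in_itv.
Qed.

(** Here f may blow up at both ends, as Y^(-1/2) does at a turning point. The usual fundamental
    theorem applies on inner segments exhausting ]a, b[; since f is nonnegative, monotone
    convergence gives the value on the whole interval, and its finiteness gives integrability. *)
Lemma ge0_FTC2_oo (R : realType) (f F : R -> R) (a b : R) : a < b ->
  {within `[a, b], continuous F} ->
  (forall x, a < x < b -> is_derive x 1 F (f x)) ->
  (forall x, a < x < b -> {for x, continuous f}) ->
  (forall x, a < x < b -> 0 <= f x) ->
  lebesgue_measure.-integrable `[a, b] (EFin \o f) /\
  (\int[lebesgue_measure]_(x in `[a, b]) f x) = F b - F a.
Proof.
move=> ab cF dF cf f0.
have mf : measurable_fun `]a, b[ f.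
  apply: open_continuous_measurable_fun; first exact: interval_open.
  by move=> x; rewrite inE /= in_itv /= => /cf.
have mEf : measurable_fun `]a, b[ (EFin \o f) by exact/measurable_EFinP.
(* The denominator starts at 3 so that already for n = 0 the inner segment [a + e n, b - e n] is
   nondegenerate. *)
pose e n : R := (b - a) / (n.+3)%:R.
have e0 n : 0 < e n by rewrite divr_gt0// subr_gt0.
have e2 n : e n + e n < b - a.
  have d0 : 0 < b - a by rewrite subr_gt0.
  rewrite /e -mulrDl ltr_pdivrMr// -mulr2n -[in ltLHS]mulr_natr ltr_pM2l//.
  by rewrite ltr_nat.
have ecvg : e n @[n --> \oo] --> (0 : R).
  rewrite /e -(mulr0 (b - a)); apply: cvgM; first exact: cvg_cst.
  have := @cvg_harmonic R; rewrite -(cvg_shiftn 2).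
  by apply: cvg_trans; apply: near_eq_cvg; apply: nearW => n; rewrite /harmonic /= addn2.
pose G n : set R := `[a + e n, b - e n]%classic.
have Gsub n x : G n x -> a < x < b.
  rewrite /G /= in_itv /= => /andP[h1 h2].
  by rewrite (lt_le_trans _ h1) ?ltrDl// (le_lt_trans h2)// gtrDl oppr_lt0.
have Gcup : \bigcup_n G n = `]a, b[%classic.
  apply/seteqP; split => x /=; first by move=> [n _ /Gsub]; rewrite in_itv.
  rewrite in_itv /= => /andP[ax xb].
  have : \forall n \near \oo, e n < Num.min (x - a) (b - x).
    apply: (cvgr_lt _ ecvg).
    by rewrite lt_min !subr_gt0 ax.
  move=> [n _ /(_ n (leqnn n))] /=; rewrite lt_min => /andP[h1 h2].
  exists n => //; rewrite /G /= in_itv /=.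
  by rewrite -lerBrDl (ltW h1) /= lerBrDr -lerBrDl ltW.
have Gmono : {homo G : n m / (n <= m)%N >-> (n <= m)%O}.
  move=> n m nm; apply/subsetPset => x; rewrite /G /= !in_itv /= => /andP[h1 h2].
  have emn : e m <= e n.
    by rewrite /e ler_pM2l ?subr_gt0// lef_pV2 ?posrE// ler_nat.
  by rewrite (le_trans _ h1) ?lerD2l//= (le_trans h2)// lerD2l lerN2.
have Gint n : (\int[lebesgue_measure]_(x in G n) (f x)%:E = (F (b - e n) - F (a + e n))%:E)%E.
  have an : a + e n < b - e n by rewrite ltrBrDr -addrA -ltrBrDl.
  rewrite EFinB; apply: continuous_FTC2 => //.
  - apply: continuous_in_subspaceT => x; rewrite inE => xn.
    by apply: cf; exact: (Gsub n).
  - have dFn x : a + e n <= x <= b - e n -> derivable F x 1.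
      by move=> h; have /dF[] : a < x < b by apply: (Gsub n); rewrite /G /= in_itv.
    have cFn x : a + e n <= x <= b - e n -> {for x, continuous F}.
      by move=> /dFn h; apply/differentiable_continuous/derivable1_diffP.
    split.
    + by move=> x; rewrite in_itv /= => /andP[/ltW h1 /ltW h2]; apply: dFn; rewrite h1.
    + by apply: cvg_at_right_filter; apply: cFn; rewrite lexx ltW.
    + by apply: cvg_at_left_filter; apply: cFn; rewrite lexx ltW.
  - move=> x; rewrite in_itv /= => /andP[/ltW h1 /ltW h2].
    have xab : a < x < b by apply: (Gsub n); rewrite /G /= in_itv /= h1.
    by have := dF x xab => dFx; rewrite derive1E derive_val.
have lim1 : (\int[lebesgue_measure]_(x in G n) (f x)%:E)%E @[n --> \oo] -->
    (\int[lebesgue_measure]_(x in `[a, b]) (f x)%:E)%E.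
  rewrite integral_itv_bndoo// -Gcup.
  apply: ge0_nondecreasing_set_cvg_integral => //.
  - by move=> n; exact: measurable_itv.
  - move=> n; apply: (measurable_funS _ _ mEf) => //.
    by move=> x /Gsub; rewrite /= in_itv.
  - by move=> n x /Gsub /f0; rewrite lee_fin.
have lim2 : (\int[lebesgue_measure]_(x in G n) (f x)%:E)%E @[n --> \oo] -->
    (F b - F a)%:E.
  under eq_fun do rewrite Gint.
  apply: cvg_EFin; first exact: nearW.
  rewrite /comp/=; apply: cvgB.
  - apply: (within_continuous_cvg cF).
    + by move=> n; have := e0 n; have := e2 n; lra.
    + by rewrite lexx ltW.
    + by rewrite -[X in _ --> X]subr0; apply: cvgB => //; exact: cvg_cst.
  - apply: (within_continuous_cvg cF).
    + by move=> n; have := e0 n; have := e2 n; lra.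
    + by rewrite lexx ltW.
    + by rewrite -[X in _ --> X]addr0; apply: cvgD => //; exact: cvg_cst.
have intE : (\int[lebesgue_measure]_(x in `[a, b]) (f x)%:E = (F b - F a)%:E)%E.
  exact: cvg_unique lim1 lim2.
split; last by rewrite /Rintegral intE.
have mabEf : measurable_fun `[a, b] (EFin \o f).
  apply/measurable_EFinP/measurable_fun_itv_bndo_bndcP/measurable_fun_itv_obnd_cbndP => //.
apply/integrableP; split => //.
have -> : (\int[lebesgue_measure]_(x in `[a, b]) `|(EFin \o f) x| =
    \int[lebesgue_measure]_(x in `[a, b]) (f x)%:E)%E.
  rewrite integral_itv_bndoo; last exact: measurableT_comp.
  rewrite [RHS]integral_itv_bndoo//; apply: eq_integral => x.
  by rewrite inE /= in_itv /= => /f0 ?; rewrite ger0_norm.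
by rewrite intE ltry.
Qed.

(** Convergence travels with the value, because the integral of a non-integrable function is still
    some real number and an equation alone would prove nothing about convergence. *)
Definition oriented_integral_is (R : realType) (a b : R) (f : R -> R) (v : R) :=
  integrable_between a b f /\ oriented_integral a b f = v.

Lemma integrable_setU_disjoint d (T : measurableType d) (R : realType)
    (mu : {measure set T -> \bar R}) (A B : set T) (f : T -> \bar R) :
  measurable A -> measurable B -> A `&` B = set0 ->
  mu.-integrable A f -> mu.-integrable B f -> mu.-integrable (A `|` B) f.
Proof.
move=> mA mB AB fA fB; apply/integrable_mkcond; first exact: measurableU.
have -> : f \_ (A `|` B) = f \_ A \+ f \_ B.
  apply/funext => x; rewrite /patch/= in_setU.
  have [xA|xA] := boolP (x \in A); have [xB|xB] := boolP (x \in B) => /=.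
  - have : x \in A `&` B by rewrite in_setI xA xB.
    by rewrite AB in_set0.
  - by rewrite adde0.
  - by rewrite add0e.
  - by rewrite adde0.
have /(integrable_mkcond _ mA) fA' := fA.
have /(integrable_mkcond _ mB) fB' := fB.
exact: integrableD.
Qed.

Section OrientedIntegral.
Context {R : realType}.
Implicit Types (a b c : R) (f g : R -> R).

Local Notation mu := lebesgue_measure.

Lemma oint_le a b f v : a <= b ->
  oriented_integral_is a b f v <->
  mu.-integrable `[a, b] (EFin \o f) /\ \int[mu]_(x in `[a, b]) f x = v.
Proof.
by move=> ab; rewrite /oriented_integral_is /integrable_between /oriented_integral
  (min_idPl ab) (max_idPr ab) ab.
Qed.

Lemma oint_sym a b f v :
  oriented_integral_is a b f v -> oriented_integral_is b a f (- v).
Proof.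
rewrite /oriented_integral_is /integrable_between minC maxC => -[fi <-]; split=> //.
rewrite /oriented_integral; case: (ltgtP a b) => ab.
- by [].
- by rewrite opprK.
- by rewrite ab set_itv1 Rintegral_set1 oppr0.
Qed.

Lemma eq_oint a b f g v :
  (forall x, Num.min a b <= x <= Num.max a b -> f x = g x) ->
  oriented_integral_is a b f v -> oriented_integral_is a b g v.
Proof.
move=> fg [fi fv]; split.
  apply: eq_integrable fi => // x; rewrite inE /= in_itv /= => /fg fgx.
  by rewrite /= fgx.
rewrite -fv /oriented_integral; case: leP => ab.
  apply: eq_Rintegral => x; rewrite inE /= in_itv /= => xab; rewrite fg//.
  by rewrite (min_idPl ab) (max_idPr ab).
congr (- _); apply: eq_Rintegral => x; rewrite inE /= in_itv /= => xab.
by rewrite fg// (min_idPr (ltW ab)) (max_idPl (ltW ab)).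
Qed.

Lemma oint_scale a b f v k : oriented_integral_is a b f v ->
  oriented_integral_is a b (fun x => k * f x) (k * v).
Proof.
wlog ab : a b v / a <= b => [hwlog|].
  case/orP: (le_total a b) => [|ba]; first exact: hwlog.
  move=> /oint_sym/(hwlog _ _ _ ba)/oint_sym.
  by rewrite mulrN opprK.
move=> /(oint_le _ _ ab)[fi <-]; apply/oint_le => //; split.
  have -> : EFin \o (fun x => k * f x) = (fun x => k%:E * (EFin \o f) x)%E.
    by apply/funext => x; rewrite /= EFinM.
  exact: integrableZl.
by rewrite RintegralZl.
Qed.

Lemma oint_cat a b c f v w : Num.min a b <= c <= Num.max a b ->
  oriented_integral_is a c f v -> oriented_integral_is c b f w ->
  oriented_integral_is a b f (v + w).
Proof.
wlog ab : a b v w / a <= b => [hwlog|].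
  case/orP: (le_total a b) => [ab|ba]; first exact: hwlog.
  move=> cab /oint_sym ac /oint_sym cb.
  have := hwlog b a _ _ ba _ cb ac; rewrite minC maxC => /(_ cab)/oint_sym.
  by rewrite opprD !opprK addrC.
rewrite (min_idPl ab) (max_idPr ab) => /andP[ac cb].
move=> /(oint_le _ _ ac)[fi <-] /(oint_le _ _ cb)[fi' <-]; apply/oint_le => //.
have abU : `[a, b]%classic = `[a, c]%classic `|` `]c, b]%classic.
  apply/seteqP; split=> x /=; rewrite !in_itv /=.
    by move=> /andP[-> ->]; rewrite !andbT; case: (leP x c) => _; [left|right].
  by move=> [/andP[-> xc]|/andP[cx ->]]; [exact: le_trans cb|rewrite (le_trans ac) ?ltW].
have fi'' : mu.-integrable `]c, b] (EFin \o f).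
  apply: integrableS fi' => //; exact: subset_itv_oc_cc.
have fU : mu.-integrable `[a, b] (EFin \o f).
  rewrite abU; apply: integrable_setU_disjoint => //.
  by apply/seteqP; split=> x //= []; rewrite !in_itv /=; lra.
split=> //.
rewrite -(Rintegral_itv_obnd_cbnd fi'') abU Rintegral_setU// -?abU//.
by rewrite disj_set2E; apply/eqP/seteqP; split=> x //= []; rewrite !in_itv /=; lra.
Qed.

Lemma oint_ge0_FTC2 a b f (F : R -> R) :
  {within `[Num.min a b, Num.max a b], continuous F} ->
  (forall x, Num.min a b < x < Num.max a b -> is_derive x 1 F (f x)) ->
  (forall x, Num.min a b < x < Num.max a b -> {for x, continuous f}) ->
  (forall x, Num.min a b < x < Num.max a b -> 0 <= f x) ->
  oriented_integral_is a b f (F b - F a).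
Proof.
wlog ab : a b / a <= b => [hwlog|].
  case/orP: (le_total a b) => [ab|ba]; first exact: hwlog.
  have := hwlog b a ba; rewrite minC maxC => h cF dF cf f0.
  by rewrite -opprB; apply: oint_sym; exact: h.
rewrite (min_idPl ab) (max_idPr ab) => cF dF cf f0; apply/oint_le => //.
move: ab; rewrite le_eqVlt => /predU1P[ab|ab]; last exact: ge0_FTC2_oo.
rewrite -ab subrr set_itv1 Rintegral_set1; split=> //.
by apply/integrableP; split; [exact: measurable_fun_set1|rewrite integral_set1].
Qed.

End OrientedIntegral.

(** * Integrals depending on parameters *)

Lemma between_itv (R : realType) (a b u v y : R) : a < u < b -> a < v < b ->
  Num.min u v <= y <= Num.max u v -> a < y < b.
Proof. by case: (ltgtP u v); lra. Qed.

Lemma between_trans (R : realType) (u v y t : R) :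
  Num.min u v <= y <= Num.max u v -> Num.min u y <= t <= Num.max u y ->
  Num.min u v <= t <= Num.max u v.
Proof. by case: (ltgtP u v); case: (ltgtP u y); lra. Qed.

(** With Y(r) = 0, the mean value theorem writes Y(x) = - 2 v1 (x - r) and Y(y) = - 2 v2 (y - r),
    where v1 and v2 are values of V. If V keeps the sign of sg, positivity of Y at x passes to every
    y between r and x. *)
Lemma same_sign_gt0 (R : realType) (v1 v2 sg x y r : R) : 0 < v1 * sg -> 0 < v2 * sg ->
  0 < - 2 * v1 * (x - r) -> Num.min r x < y < Num.max r x -> 0 < - 2 * v2 * (y - r).
Proof.
move=> V1 V2 Yx yrx.
have [s0|s0|s0] := ltgtP sg 0; last by rewrite s0 mulr0 ltxx in V1.
- rewrite !nmulr_lgt0// in V1 V2.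
  by case: (ltgtP r x) yrx => rx /andP[h1 h2]; nra.
- rewrite !pmulr_lgt0// in V1 V2.
  by case: (ltgtP r x) yrx => rx /andP[h1 h2]; nra.
Qed.

Lemma continuous_at_pair (X Y Z : topologicalType) (f : X -> Y) (g : X -> Z) (x : X) :
  {for x, continuous f} -> {for x, continuous g} ->
  {for x, continuous (fun y => (f y, g y))}.
Proof.
move=> cf cg.
exact: (@cvg_pair _ _ _ (nbhs x) (nbhs (f x)) (nbhs (g x)) _ _ _ f g cf cg).
Qed.

Lemma continuous_at_fst (X Y : topologicalType) (z : X * Y) :
  {for z, continuous (@fst X Y)}.
Proof. by case: z => x y; exact: (@cvg_fst _ _ (nbhs x) (nbhs y)). Qed.

Lemma continuous_at_snd (X Y : topologicalType) (z : X * Y) :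
  {for z, continuous (@snd X Y)}.
Proof. by case: z => x y; exact: (@cvg_snd _ _ (nbhs x) (nbhs y)). Qed.

Lemma MVT_between (R : realType) (f df : R -> R) (a b : R) :
  (forall x, Num.min a b <= x <= Num.max a b -> is_derive x 1 f (df x)) ->
  exists2 c, Num.min a b <= c <= Num.max a b & f b - f a = df c * (b - a).
Proof.
wlog ab : a b / a <= b => [hwlog|].
  case/orP: (le_total a b) => [ab|ba]; first exact: hwlog.
  rewrite minC maxC => h; have [c cab fE] := hwlog _ _ ba h.
  by exists c => //; rewrite -opprB fE -mulrN opprB.
rewrite (min_idPl ab) (max_idPr ab) => dfx.
have [||c cab fE] := @MVT_segment _ f df a b ab.
- by move=> x; rewrite in_itv /= => /andP[/ltW ax /ltW xb]; apply: dfx; rewrite ax.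
- apply: derivable_within_continuous => x; rewrite in_itv /= => /dfx[].
  by [].
- by exists c.
Qed.

Lemma near_fst (X Y : topologicalType) (P : set X) (z : X * Y) :
  nbhs z.1 P -> \forall y \near z, P y.1.
Proof. by move=> h; exact: (continuous_at_fst h). Qed.

Lemma near_snd (X Y : topologicalType) (P : set Y) (z : X * Y) :
  nbhs z.2 P -> \forall y \near z, P y.2.
Proof. by move=> h; exact: (continuous_at_snd h). Qed.

(** Tube lemma: by compactness of [a, b], pointwise neighbourhoods of the (p, x) contain a common
    neighbourhood of p. *)
Lemma near_segment (R : realType) (T : topologicalType) (P : set (T * R)) (p : T) (a b : R) :
  (forall x, a <= x <= b -> \forall z \near (p, x), P z) ->
  \forall q \near p, forall x, a <= x <= b -> P (q, x).
Proof.
move=> nP.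
have := (compact_near_coveringP `[a, b]%classic).1 (@segment_compact R a b).
move=> /(_ T (nbhs p) (fun q x => P (q, x)) _) H.
have {H} : \forall q \near p, `[a, b] `<=` [set x | P (q, x)].
  apply: H => x; rewrite /= in_itv /= => xab.
  have cs : {for (x, p), continuous (fun z : R * T => (z.2, z.1))}.
    exact: (continuous_at_pair (@continuous_at_snd _ _ _) (@continuous_at_fst _ _ _)).
  have H1 : \forall z \near (x, p), P (z.2, z.1) := cs _ (nP x xab).
  exact: H1.
by apply: filterS => q h x xab; apply: h; rewrite /= in_itv.
Qed.

Lemma near_compact_uniform (R : realType) (T : topologicalType) (g : T * R -> R)
    (p : T) (a b : R) :
  (forall x, a <= x <= b -> {for (p, x), continuous g}) ->
  forall e : R, 0 < e -> \forall q \near p, forall x, a <= x <= b ->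
    `|g (q, x) - g (p, x)| <= e.
Proof.
move=> cg e e0; have e2 : 0 < e / 2 by rewrite divr_gt0.
apply: (near_segment (P := fun z => `|g z - g (p, z.2)| <= e)) => x xab.
have n1 : \forall z \near (p, x), `|g (p, x) - g z| <= e / 2.
  by have /cvgr_dist_le := cg x xab; apply.
have cs : {for (p, x), continuous (fun z : T * R => (p, z.2))}.
  by apply: continuous_at_pair; [exact: cvg_cst|exact: continuous_at_snd].
have n2 : \forall z \near (p, x), `|g (p, x) - g (p, z.2)| <= e / 2 := cs _ n1.
apply: filterS2 n1 n2 => z h1 h2.
rewrite (le_trans (ler_distD (g (p, x)) _ _))// [leRHS]splitr lerD//.
by rewrite distrC.
Qed.

(** An open condition on a segment leaves some room on both sides. The room makes the base radius
    and the upper bound interior points, where the integral can be differentiated. *)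
Lemma widen_segment (R : realType) (P : set R) (a b : R) : a <= b ->
  (forall x, P x -> \forall y \near x, P y) -> (forall x, a <= x <= b -> P x) ->
  exists c d, [/\ c < a, b < d & forall x, c <= x <= d -> P x].
Proof.
move=> ab oP abP.
have Pa : \forall y \near a, P y by apply/oP/abP; rewrite lexx ab.
have Pb : \forall y \near b, P y by apply/oP/abP; rewrite lexx ab.
have [d1 /= d10 dP1] := (nbhs_ballP _ _).1 Pa.
have [d2 /= d20 dP2] := (nbhs_ballP _ _).1 Pb.
exists (a - d1 / 2), (b + d2 / 2); split; [by lra|by lra|move=> x /andP[h1 h2]].
case: (ltP x a) => xa.
  by apply: dP1; rewrite -ball_normE /= gtr0_norm ?subr_gt0//; lra.
case: (leP x b) => xb; first by apply: abP; rewrite xa.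
by apply: dP2; rewrite -ball_normE /= ltr0_norm ?subr_lt0//; lra.
Qed.

Lemma integrable_segment (R : realType) (f : R -> R) (a b : R) :
  (forall x, a <= x <= b -> {for x, continuous f}) ->
  lebesgue_measure.-integrable `[a, b] (EFin \o f).
Proof.
move=> cf; apply: continuous_compact_integrable; first exact: segment_compact.
by apply: continuous_in_subspaceT => x; rewrite inE /= in_itv => /cf.
Qed.

Lemma normr_Rintegral_segment_le (R : realType) (f : R -> R) (a b M : R) : a <= b ->
  lebesgue_measure.-integrable `[a, b] (EFin \o f) ->
  (forall x, a <= x <= b -> `|f x| <= M) ->
  `|\int[lebesgue_measure]_(x in `[a, b]) f x| <= M * (b - a).
Proof.
move=> ab fi fM; rewrite (le_trans (le_normr_Rintegral _ _))//.
have -> : M * (b - a) = \int[lebesgue_measure]_(x in `[a, b]) M.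
  rewrite Rintegral_cst//= lebesgue_measure_itv /= lte_fin.
  by move: ab; rewrite le_eqVlt => /predU1P[<-|->//]; rewrite ltxx subrr.
apply: le_Rintegral; [by []|exact: integrable_norm| |by move=> x; rewrite /= in_itv => /fM].
by apply: integrable_segment => x _; exact: cvg_cst.
Qed.

Lemma norm_prodE (K : numDomainType) (U V : normedZmodType K) (z : U * V) :
  `|z| = Num.max `|z.1| `|z.2|.
Proof. by []. Qed.

Lemma ball_between (R : realType) (u v w d : R) :
  Num.min u v <= w <= Num.max u v -> ball u d v -> ball u d w.
Proof.
rewrite -!ball_normE /= (distrC u v) (distrC u w); case: (ltgtP u v) => uv /andP[h1 h2] h.
- by rewrite ger0_norm ?subr_ge0// (le_lt_trans _ h)// gtr0_norm ?subr_gt0// lerB.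
- rewrite ltr0_norm ?subr_lt0// opprB in h.
  by rewrite ler0_norm ?subr_le0// opprB (le_lt_trans _ h)// lerB.
- have -> : w = u by lra.
  by rewrite subrr normr0 (le_lt_trans _ h).
Qed.

(** * Differentiation under the integral sign, with a moving upper bound *)

Section ParametricIntegral.
Context {R : realType}.
Variables (O : set (R * R)) (a b : R) (k kl ke : R * R * R -> R).
Hypotheses (oO : open O) (ck : forall z, O z.1 -> a <= z.2 <= b -> {for z, continuous k})
  (ckl : forall z, O z.1 -> a <= z.2 <= b -> {for z, continuous kl})
  (cke : forall z, O z.1 -> a <= z.2 <= b -> {for z, continuous ke})
  (dkl : forall l e x, O (l, e) -> a <= x <= b ->
    is_derive l 1 (fun l' => k (l', e, x)) (kl (l, e, x)))
  (dke : forall l e x, O (l, e) -> a <= x <= b ->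
    is_derive e 1 (fun e' => k (l, e', x)) (ke (l, e, x))).

Local Notation mu := lebesgue_measure.

Let section_continuous (g : R * R * R -> R) p x :
  {for (p, x), continuous g} -> {for x, continuous (fun y => g (p, y))}.
Proof.
move=> cg; have cs : {for x, continuous (fun y : R => (p, y))}.
  by apply: continuous_at_pair; [exact: cvg_cst|exact: cvg_id].
exact: (continuous_comp cs cg).
Qed.

Let section_integrable (g : R * R * R -> R) p s : a < s < b ->
  (forall x, a <= x <= b -> {for (p, x), continuous g}) ->
  mu.-integrable `[a, s] (EFin \o (fun y => g (p, y))).
Proof.
move=> /andP[_ /ltW sb] cg; apply: integrable_segment => x /andP[ax xs].
by apply: section_continuous; apply: cg; rewrite ax (le_trans xs).
Qed.

(** Continuous partial derivatives give differentiability, here with an error uniform in x. The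
    increment is split at the corner (l0, e'), and the mean value theorem is applied on each leg.
    Balls for the max norm are products, so both legs stay in O. *)
Lemma increment_bound p : O p -> forall e : R, 0 < e ->
  \forall q \near p, forall x, a <= x <= b ->
    `|k (q, x) - k (p, x) - (kl (p, x) * (q.1 - p.1) + ke (p, x) * (q.2 - p.2))|
    <= e * `|q - p|.
Proof.
case: p => l0 e0' Op e e0; have e2 : 0 < e / 2 by rewrite divr_gt0.
have n1 := near_compact_uniform (fun x xab => ckl (z := ((l0, e0'), x)) Op xab) e2.
have n2 := near_compact_uniform (fun x xab => cke (z := ((l0, e0'), x)) Op xab) e2.
have n3 : \forall q \near (l0, e0'), O q by exact: open_nbhs_nbhs.
have n4 : nbhs (l0, e0') (O `&` ([set q | forall x, a <= x <= b -> `|kl (q, x) - kl ((l0, e0'), x)| <= e / 2]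
    `&` [set q | forall x, a <= x <= b -> `|ke (q, x) - ke ((l0, e0'), x)| <= e / 2])).
  exact: filterI n3 (filterI n1 n2).
have [d /= d0 dP] := (nbhs_ballP _ _).1 n4.
apply/nbhs_ballP.
exists d => //= -[l' e'] [/= pl pe] x xab.
have dP1 l1 : Num.min l0 l' <= l1 <= Num.max l0 l' ->
    O (l1, e') /\ `|kl ((l1, e'), x) - kl ((l0, e0'), x)| <= e / 2.
  move=> h; have [|? [h1 _]] := dP (l1, e'); last by split=> //; exact: h1.
  by split => //=; exact: (ball_between h).
have dP2 e1 : Num.min e0' e' <= e1 <= Num.max e0' e' ->
    O (l0, e1) /\ `|ke ((l0, e1), x) - ke ((l0, e0'), x)| <= e / 2.
  move=> h; have [|? [_ h1]] := dP (l0, e1); last by split=> //; exact: h1.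
  by split => /=; [exact: ballxx|exact: (ball_between h)].
have [l1 /dP1[_ l1P] E1] := MVT_between (fun l1 h => dkl (dP1 l1 h).1 xab).
have [e1 /dP2[_ e1P] E2] := MVT_between (fun e1 h => dke (dP2 e1 h).1 xab).
have -> : k (l', e', x) - k (l0, e0', x) -
   (kl (l0, e0', x) * (l' - l0) + ke (l0, e0', x) * (e' - e0')) =
   (kl (l1, e', x) - kl (l0, e0', x)) * (l' - l0) +
   (ke (l0, e1, x) - ke (l0, e0', x)) * (e' - e0').
  by move: E1 E2 => /eqP; rewrite subr_eq => /eqP -> /eqP; rewrite subr_eq => /eqP ->; ring.
rewrite (le_trans (ler_normD _ _))// !normrM.
have ql : `|l' - l0| <= `|(l', e') - (l0, e0')| by rewrite norm_prodE /= le_max lexx.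
have qe : `|e' - e0'| <= `|(l', e') - (l0, e0')| by rewrite norm_prodE /= le_max lexx orbT.
by rewrite [in leRHS](splitr e) mulrDl lerD// ler_pM.
Qed.

Lemma parametric_integral_approx p s : O p -> a < s < b -> forall e : R, 0 < e ->
  \forall q \near p,
    `|\int[mu]_(x in `[a, s]) k (q, x) - \int[mu]_(x in `[a, s]) k (p, x)
      - ((\int[mu]_(x in `[a, s]) kl (p, x)) * (q.1 - p.1)
        + (\int[mu]_(x in `[a, s]) ke (p, x)) * (q.2 - p.2))| <= e * `|q - p|.
Proof.
move=> Op sab e e0.
have sa0 : 0 < s - a by lra.
have e'0 : 0 < e / (s - a) by rewrite divr_gt0.
have nO : \forall q \near p, O q by exact: open_nbhs_nbhs.
have nk := increment_bound Op e'0.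
apply: filterS2 nO nk => q Oq kq.
have ik p' : O p' -> mu.-integrable `[a, s] (EFin \o (fun y => k (p', y))).
  by move=> Op'; apply: section_integrable => // x xab; exact: ck.
have ikl : mu.-integrable `[a, s] (EFin \o (fun y => kl (p, y))).
  by apply: section_integrable => // x xab; exact: ckl.
have ike : mu.-integrable `[a, s] (EFin \o (fun y => ke (p, y))).
  by apply: section_integrable => // x xab; exact: cke.
have ck' p' x : O p' -> a <= x <= s -> {for x, continuous (fun y => k (p', y))}.
  by move=> Op' /andP[ax xs]; apply: section_continuous; apply: ck => //=; lra.
have ckl' x : a <= x <= s -> {for x, continuous (fun y => kl (p, y))}.
  by move=> /andP[ax xs]; apply: section_continuous; apply: ckl => //=; lra.
have cke' x : a <= x <= s -> {for x, continuous (fun y => ke (p, y))}.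
  by move=> /andP[ax xs]; apply: section_continuous; apply: cke => //=; lra.
have i1 : mu.-integrable `[a, s] (EFin \o (fun y => k (q, y) - k (p, y))).
  by apply: integrable_segment => x xas; apply: cvgB; exact: ck'.
have i2 : mu.-integrable `[a, s] (EFin \o (fun y => kl (p, y) * (q.1 - p.1))).
  by apply: integrable_segment => x xas; apply: cvgM; [exact: ckl'|exact: cvg_cst].
have i3 : mu.-integrable `[a, s] (EFin \o (fun y => ke (p, y) * (q.2 - p.2))).
  by apply: integrable_segment => x xas; apply: cvgM; [exact: cke'|exact: cvg_cst].
have i4 : mu.-integrable `[a, s] (EFin \o
    (fun y => kl (p, y) * (q.1 - p.1) + ke (p, y) * (q.2 - p.2))).
  apply: integrable_segment => x xas; apply: cvgD; apply: cvgM;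
    by [exact: ckl'|exact: cke'|exact: cvg_cst].
have i5 : mu.-integrable `[a, s] (EFin \o (fun y => k (q, y) - k (p, y) -
    (kl (p, y) * (q.1 - p.1) + ke (p, y) * (q.2 - p.2)))).
  apply: integrable_segment => x xas; apply: cvgB; [apply: cvgB|apply: cvgD; apply: cvgM];
    by [exact: ck'|exact: ckl'|exact: cke'|exact: cvg_cst].
rewrite -!RintegralZr// -RintegralD// -RintegralB//; [|exact: ik..].
rewrite -RintegralB//.
have -> : e * `|q - p| = e / (s - a) * `|q - p| * (s - a).
  by rewrite mulrAC divfK// gt_eqF.
apply: normr_Rintegral_segment_le => //; first by lra.
by move=> x /andP[ax xs]; apply: kq; lra.
Qed.

Lemma is_derive_upper_bound p s : O p -> a < s < b ->
  is_derive s 1 (fun s' => \int[mu]_(x in `[a, s']) k (p, x)) (k (p, s)).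
Proof.
move=> Op /andP[as_ sb].
have ik : mu.-integrable `[a, b] (EFin \o (fun y => k (p, y))).
  by apply: integrable_segment => x xab; apply: section_continuous; exact: ck.
have cs : {for s, continuous (fun y => k (p, y))}.
  by apply: section_continuous; apply: ck => //=; rewrite !ltW.
have [dF <-] := continuous_FTC1_closed sb ik as_ cs.
by rewrite derive1E; exact: derivableP dF.
Qed.

(** The increment is split in two: first the parameter moves with the upper bound fixed at s, then
    the upper bound moves at the new parameter. The second part is a mean value of k by the
    fundamental theorem, and joint continuity of k controls it. Each part receives half of the
    error. *)
Lemma differentiable_parametric_integral p s : O p -> a < s < b ->
  differentiable (fun z : R * R * R => \int[mu]_(x in `[a, z.2]) k (z.1, x)) (p, s).
Proof.
move=> Op sab; set F := fun z : R * R * R => _.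
pose c1 := \int[mu]_(x in `[a, s]) kl (p, x).
pose c2 := \int[mu]_(x in `[a, s]) ke (p, x).
pose df (h : R * R * R) : R := c1 * h.1.1 + c2 * h.1.2 + k (p, s) * h.2.
have dfl : linear df.
  by move=> r [[x1 x2] x3] [[y1 y2] y3]; rewrite /df /= /GRing.scale /=; ring.
pose dfM := GRing.isLinear.Build _ _ _ _ _ dfl.
pose dfL : {linear (R * R * R)%type -> R^o} := HB.pack df dfM.
have cdf : continuous dfL.
  move=> z; apply: cvgD; first apply: cvgD.
  - apply: cvgM; first exact: cvg_cst.
    exact: (continuous_comp (@continuous_at_fst _ _ z) (@continuous_at_fst _ _ z.1)).
  - apply: cvgM; first exact: cvg_cst.
    exact: (continuous_comp (@continuous_at_fst _ _ z) (@continuous_at_snd _ _ z.1)).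
  - by apply: cvgM; [exact: cvg_cst|exact: continuous_at_snd].
have [] // := @differentiable_approx R _ _ F dfL (p, s) cdf.
move=> e e0; have e2 : 0 < e / 2 by rewrite divr_gt0.
have n1 := parametric_integral_approx Op sab e2.
have cks : {for (p, s), continuous k} by apply: ck => //=; lra.
have n2 : \forall z \near (p, s), `|k (p, s) - k z| <= e / 2.
  by have /cvgr_dist_le := cks; apply.
have n3 : \forall q \near p, O q by exact: open_nbhs_nbhs.
have n4 : \forall s' \near s, a < s' < b.
  have : nbhs s `]a, b[%classic by apply: open_nbhs_nbhs; split; [exact: interval_open|rewrite /= in_itv].
  by apply: filterS => s'; rewrite /= in_itv.
have [d1 /= d10 dP1] := (nbhs_ballP _ _).1 (filterI n1 n3).
have [d2 /= d20 dP2] := (nbhs_ballP _ _).1 n2.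
have [d3 /= d30 dP3] := (nbhs_ballP _ _).1 n4.
pose d := Num.min d1 (Num.min d2 d3).
apply/nbhs_ballP; exists d; first by rewrite /= !lt_min d10 d20.
move=> [q s'] [/= pq ss'].
have [ dd1 [dd2 dd3]] : d <= d1 /\ d <= d2 /\ d <= d3.
  by rewrite /d !ge_min !lexx !orbT.
have [/= qP Oq] := dP1 q (le_ball dd1 pq).
have xab x : Num.min s s' <= x <= Num.max s s' -> a < x < b.
  by move=> h; apply: dP3; apply: (ball_between h); exact: le_ball ss'.
have [x xs xE] := MVT_between (fun x h => is_derive_upper_bound Oq (xab x h)).
have kx : `|k (q, x) - k (p, s)| <= e / 2.
  rewrite distrC; apply: dP2; split => /=; first exact: le_ball pq.
  by apply: (ball_between xs); exact: le_ball ss'.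
have -> : F (q, s') - F (p, s) - dfL ((q, s') - (p, s)) =
    (F (q, s) - F (p, s) - (c1 * (q.1 - p.1) + c2 * (q.2 - p.2))) +
    (k (q, x) - k (p, s)) * (s' - s).
  move/eqP : xE; rewrite subr_eq -/(F (q, s')) => /eqP.
  by rewrite [LHS]/(F (q, s')) /F /= /df /= => ->; ring.
rewrite (le_trans (ler_normD _ _))// [in leRHS](splitr e) [leRHS]mulrDl lerD//.
  apply: (le_trans qP); rewrite ler_wpM2l ?(ltW e2)//.
  by rewrite [leRHS]norm_prodE /= le_max lexx.
rewrite normrM ler_pM//.
by rewrite [leRHS]norm_prodE /= le_max lexx orbT.
Qed.

End ParametricIntegral.

(** * Pointwise differentiation rules *)

Section PointwiseCalculus.
Context {R : realType}.
Implicit Types (V : normedModType R).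

Lemma differentiable_fun_const V (c : R) (z : V) : differentiable (fun=> c) z.
Proof. exact: differentiable_cst. Qed.

Lemma differentiable_funD V (f g : V -> R) z :
  differentiable f z -> differentiable g z -> differentiable (fun y => f y + g y) z.
Proof. exact: differentiableD. Qed.

Lemma differentiable_funN V (f : V -> R) z :
  differentiable f z -> differentiable (fun y => - f y) z.
Proof. exact: differentiableN. Qed.

Lemma differentiable_funM V (f g : V -> R) z :
  differentiable f z -> differentiable g z -> differentiable (fun y => f y * g y) z.
Proof. exact: differentiableM. Qed.

Lemma differentiable_funX V (f : V -> R) n z :
  differentiable f z -> differentiable (fun y => f y ^+ n) z.
Proof.
move=> df; elim: n => [|n IHn]; first exact: differentiable_fun_const.
under eq_fun do rewrite exprS.
exact: differentiable_funM.
Qed.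

Lemma differentiable_fun_comp V (h : R -> R) (f : V -> R) z :
  derivable h (f z) 1 -> differentiable f z -> differentiable (fun y => h (f y)) z.
Proof. by move=> /derivable1_diffP dh df; exact: differentiable_comp. Qed.

Lemma differentiable_funV V (f : V -> R) z : f z != 0 ->
  differentiable f z -> differentiable (fun y => (f y)^-1) z.
Proof.
move=> fz df; apply: (differentiable_comp df).
exact: differentiable_Rinv.
Qed.

Lemma differentiable_fun_fst (V W : normedModType R) (z : V * W) :
  differentiable (fun y => y.1) z.
Proof.
apply: (@linear_differentiable R (V * W)%type V (@fst V W : {linear (V * W)%type -> V})).
exact: continuous_at_fst.
Qed.

Lemma differentiable_fun_snd (V W : normedModType R) (z : V * W) :
  differentiable (fun y => y.2) z.
Proof.
apply: (@linear_differentiable R (V * W)%type W (@snd V W : {linear (V * W)%type -> W})).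
exact: continuous_at_snd.
Qed.

Lemma differentiable_fun_fst_comp (V W W' : normedModType R) (f : V -> W * W') z :
  differentiable f z -> differentiable (fun y => (f y).1) z.
Proof.
by move=> df; apply: (differentiable_comp df); exact: differentiable_fun_fst.
Qed.

Lemma differentiable_fun_snd_comp (V W W' : normedModType R) (f : V -> W * W') z :
  differentiable f z -> differentiable (fun y => (f y).2) z.
Proof.
by move=> df; apply: (differentiable_comp df); exact: differentiable_fun_snd.
Qed.

Lemma differentiable_fun_id V (z : V) : differentiable (fun y => y) z.
Proof. by have [] := is_diff_id z. Qed.

Implicit Types (f g : R -> R) (x : R).

Lemma is_derive_cast f x a b : is_derive x 1 f a -> a = b -> is_derive x 1 f b.
Proof. by move=> ? <-. Qed.

Lemma is_derive_fun_const (c x : R) : is_derive x 1 (fun=> c) 0.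
Proof. exact: is_derive_cst. Qed.

Lemma is_derive_fun_id x : is_derive x 1 (fun y => y) 1.
Proof. exact: is_derive_id. Qed.

Lemma is_derive_funD f g x a b : is_derive x 1 f a -> is_derive x 1 g b ->
  is_derive x 1 (fun y => f y + g y) (a + b).
Proof. by move=> fa gb; exact: is_deriveD. Qed.

Lemma is_derive_funN f x a : is_derive x 1 f a -> is_derive x 1 (fun y => - f y) (- a).
Proof. by move=> fa; exact: is_deriveN. Qed.

Lemma is_derive_funM f g x a b : is_derive x 1 f a -> is_derive x 1 g b ->
  is_derive x 1 (fun y => f y * g y) (f x * b + g x * a).
Proof. by move=> fa gb; exact: is_deriveM. Qed.

Lemma is_derive_fun_comp (h : R -> R) f x a b :
  is_derive (f x) 1 h b -> is_derive x 1 f a -> is_derive x 1 (fun y => h (f y)) (b * a).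
Proof. by move=> hb fa; exact: is_derive1_comp. Qed.

Lemma is_derive_funX f n x a : is_derive x 1 f a ->
  is_derive x 1 (fun y => f y ^+ n) (n%:R * f x ^+ n.-1 * a).
Proof.
move=> fa; elim: n => [|n IHn].
  by rewrite mulr0n !mul0r; exact: is_derive_fun_const.
under eq_fun do rewrite exprS.
apply: (is_derive_cast (is_derive_funM fa IHn)).
by case: n {IHn} => [|n] /=; rewrite ?exprS; ring.
Qed.

Lemma is_derive_funV f x a : f x != 0 -> is_derive x 1 f a ->
  is_derive x 1 (fun y => (f y)^-1) (- (f x ^+ 2)^-1 * a).
Proof.
move=> fx [fd fa]; have := @deriveV _ _ _ _ _ fx fd; have := derivableV fx fd.
move=> dV dE; apply: DeriveDef => //.
by rewrite -[LHS]/('D_1 (fun y => (f y)^-1) x) dE fa /GRing.scale.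
Qed.

Lemma is_derive_fun_sqrt f x a : 0 < f x -> is_derive x 1 f a ->
  is_derive x 1 (fun y => Num.sqrt (f y)) ((2 * Num.sqrt (f x))^-1 * a).
Proof. by move=> fx; apply: is_derive_fun_comp; exact: is_derive1_sqrt. Qed.

(** This is y^(3/2) extended by 0 to negative y. The formula holds on the whole line with a
    continuous right-hand side, which lets the remainder cross a zero of the radicand. *)
Lemma is_derive_mul_sqrt x : is_derive x 1 (fun y => y * Num.sqrt y) (3 / 2 * Num.sqrt x).
Proof.
case: (ltgtP x 0) => x0.
- rewrite ltr0_sqrtr// mulr0.
  apply: (near_eq_is_derive _ (is_derive_fun_const 0 x)).
  by near=> y; rewrite ltr0_sqrtr ?mulr0//; near: y; exact: lt_nbhsl.
- apply: (is_derive_cast (is_derive_funM (is_derive_fun_id x) (is_derive1_sqrt x0))).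
  have s0 : Num.sqrt x != 0 by rewrite gt_eqF// sqrtr_gt0.
  by rewrite -{1}(sqr_sqrtr (ltW x0)); field.
- rewrite x0 sqrtr0 mulr0.
  (* At 0 the difference quotient is exactly [Num.sqrt h], which is continuous and vanishes at 0. *)
  have lim : h^-1 *: ((h *: 1 + 0) * Num.sqrt (h *: 1 + 0) - 0 * Num.sqrt 0) @[h --> (0 : R)^'] --> (0 : R).
    rewrite -[X in _ --> X](@sqrtr0 R).
    apply: cvg_trans (cvg_within_filter _ (@sqrt_continuous R 0)).
    apply: near_eq_cvg; near=> h.
    have h0 : h != 0 by near: h; exact: nbhs_dnbhs_neq.
    by rewrite mul0r subr0 addr0 /GRing.scale /= mulr1 mulrA mulVf// mul1r.
  apply: DeriveDef; first by apply/cvg_ex; exists 0.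
  exact: cvg_lim lim.
Unshelve. all: by end_near. Qed.

End PointwiseCalculus.

Ltac differentiable_step :=
  first [ apply: differentiable_fun_const
        | apply: differentiable_funD
        | apply: differentiable_funN
        | apply: differentiable_funX
        | apply: differentiable_funM
        | apply: differentiable_funV
        | apply: differentiable_pair
        | apply: differentiable_fun_id
        | apply: differentiable_fun_fst
        | apply: differentiable_fun_snd
        | apply: differentiable_fun_fst_comp
        | apply: differentiable_fun_snd_comp ].

Ltac derive_step :=
  first [ eassumption
        | eapply is_derive_fun_const
        | eapply is_derive_fun_id
        | eapply is_derive_funD
        | eapply is_derive_funN
        | eapply is_derive_funX
        | eapply is_derive_funM
        | eapply is_derive_funV ].

(** * Primitives away from and near turning points *)

Section Radicand.
Context {R : realType}.
Variables (U : R -> R) (ueq : R).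
Hypothesis hU : smooth_potential U.

Definition radicand (z : R * R * R) : R := time_radicand U ueq z.1.1 z.1.2 z.2.

(** This is Ueff'(x), so Y' = - 2 V in the radius. The energy slot does not enter the value; it
    gives [force] the same argument (L, E, x) as [radicand]. *)
Definition force (z : R * R * R) : R := derive1 U z.2 - z.1.1 ^+ 2 * z.2 ^- 3.

Lemma is_derive_potential n (x : R) : 0 < x ->
  is_derive x 1 (derive1n n U) (derive1n n.+1 U x).
Proof. by move=> x0; have dU := @hU n x x0; rewrite derive1nS derive1E; exact: derivableP. Qed.

Lemma differentiable_radicand (z : R * R * R) : 0 < z.2 -> differentiable radicand z.
Proof.
move=> z0; have z2 : z.2 ^+ 2 != 0 by rewrite sqrf_eq0 gt_eqF.
have dU := @hU 0 _ z0.
rewrite /radicand /time_radicand; repeat differentiable_step => //.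
by apply: (differentiable_fun_comp dU); repeat differentiable_step.
Qed.

Lemma is_derive_radicand (l e x : R) : 0 < x ->
  is_derive x 1 (fun y => radicand (l, e, y)) (- 2 * force (l, e, x)).
Proof.
move=> x0; have dU := is_derive_potential 0 x0; have xn0 : x != 0 by rewrite gt_eqF.
have x2 : x ^+ 2 != 0 by rewrite sqrf_eq0.
rewrite /radicand /time_radicand /=; eapply is_derive_cast; first by repeat derive_step.
by rewrite /force /=; field.
Qed.

Lemma is_derive_radicand_l (l e x : R) :
  is_derive l 1 (fun l' => radicand (l', e, x)) (- (2 * l * x ^- 2)).
Proof.
rewrite /radicand /time_radicand /=; eapply is_derive_cast; first by repeat derive_step.
by move=> /=; ring.
Qed.

Lemma is_derive_radicand_e (l e x : R) : is_derive e 1 (fun e' => radicand (l, e', x)) 2.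
Proof.
rewrite /radicand /time_radicand /=; eapply is_derive_cast; first by repeat derive_step.
by move=> /=; ring.
Qed.

Lemma continuous_radicand (z : R * R * R) : 0 < z.2 -> {for z, continuous radicand}.
Proof. by move=> z0; exact/differentiable_continuous/differentiable_radicand. Qed.

Lemma near_radicand_gt0 (z : R * R * R) : 0 < z.2 -> 0 < radicand z ->
  \forall y \near z, 0 < y.2 /\ 0 < radicand y.
Proof.
move=> z0 Yz; have n1 : \forall y \near z, 0 < radicand y.
  by have /cvgr_gt := continuous_radicand z0; apply.
have n2 : \forall y \near z, 0 < y.2.
  by apply: (@near_snd (R * R)%type R (fun x => 0 < x) z); exact: lt_nbhsr.
by apply: filterS2 n2 n1 => y.
Qed.

(** The integral identity is required on a whole neighbourhood of (p, s), with the base radius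
    rho(L, E) moving along: only then does differentiating G say something about the integral. Of
    the partial derivatives of G only the radial one is recorded. *)
Definition primitive_near (w : R -> R) (rho : R * R -> R)
    (p : R * R) (s : R) (G : R * R * R -> R) :=
  \forall z \near (p, s), [/\ differentiable G z, 0 < z.2, 0 < radicand z,
    is_derive z.2 1 (fun x => G (z.1, x)) (w z.2 / Num.sqrt (radicand z))
  & oriented_integral_is (rho z.1) z.2 (fun x => w x / Num.sqrt (radicand (z.1, x))) (G z)].

(** The integrand has no singularity on the closed segment, so the parameters can be differentiated
    under the integral sign. Besides branches of radii, rho may be a constant, which serves for the
    part of the integral away from a turning point. *)
Lemma primitive_near_regular (w w' : R -> R) (rho : R * R -> R) (p : R * R) (s : R) :
  (forall x : R, 0 < x -> is_derive x 1 w (w' x)) ->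
  (forall x : R, 0 < x -> 0 < w x) ->
  (\forall q \near p, differentiable rho q) ->
  (forall x, Num.min (rho p) s <= x <= Num.max (rho p) s -> 0 < x /\ 0 < radicand (p, x)) ->
  exists G, primitive_near w rho p s G.
Proof.
move=> dw w0 drho Yps.
have mM : Num.min (rho p) s <= Num.max (rho p) s by rewrite ge_min !le_max !lexx.
(* Integrals will start from this fixed a, below both radii; the integral from rho is then a
   difference of two values of the single function [F]. *)
have [a [b [am Mb abY]]] : exists a b, [/\ a < Num.min (rho p) s, Num.max (rho p) s < b &
    forall x, a <= x <= b -> 0 < x /\ 0 < radicand (p, x)].
  apply: widen_segment => // x [x0 Yx].
  have cs : {for x, continuous (fun y : R => (p, y))}.
    by apply: continuous_at_pair; [exact: cvg_cst|exact: cvg_id].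
  exact: (cs _ (near_radicand_gt0 (z := (p, x)) x0 Yx)).
have nO1 : \forall q \near p, forall x, a <= x <= b -> 0 < radicand (q, x).
  apply: (near_segment (P := fun z => 0 < radicand z)) => x xab.
  have [x0 Yx] := abY x xab.
  by apply: filterS (near_radicand_gt0 (z := (p, x)) x0 Yx) => y [].
(* The interior provides the open parameter set that differentiation under the integral sign asks
   for. *)
pose O : set (R * R) := interior ([set q | forall x, a <= x <= b -> 0 < radicand (q, x)]
  `&` [set q | differentiable rho q]).
have oO : open O by exact: open_interior.
have Op : O p by exact: filterI nO1 drho.
have OY q x : O q -> a <= x <= b -> 0 < radicand (q, x).
  by move=> /interior_subset[+ _]; exact.
have Orho q : O q -> differentiable rho q by move=> /interior_subset[].
have ab0 x : a <= x <= b -> 0 < x by move=> /abY[].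
pose k z : R := w z.2 / Num.sqrt (radicand z).
pose kl z : R := w z.2 * (z.1.1 * z.2 ^- 2) / (radicand z * Num.sqrt (radicand z)).
pose ke z : R := - w z.2 / (radicand z * Num.sqrt (radicand z)).
have dk z : 0 < z.2 -> 0 < radicand z ->
    [/\ differentiable k z, differentiable kl z & differentiable ke z].
  move=> z0 Yz; have dwz : derivable w z.2 1 by have [] := dw _ z0.
  have z2 : z.2 ^+ 2 != 0 by rewrite sqrf_eq0 gt_eqF.
  have dY := differentiable_radicand z0.
  have sY : Num.sqrt (radicand z) != 0 by rewrite gt_eqF// sqrtr_gt0.
  have YsY : radicand z * Num.sqrt (radicand z) != 0 by rewrite mulf_neq0// gt_eqF.
  have dsY : differentiable (fun y => Num.sqrt (radicand y)) z.
    by apply: differentiable_fun_comp => //; have [] := is_derive1_sqrt Yz.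
  have dw2 : differentiable (fun y : R * R * R => w y.2) z.
    by apply: differentiable_fun_comp => //; exact: differentiable_fun_snd.
  by split; rewrite /k /kl /ke; repeat (first [assumption | differentiable_step]).
have Oz z : O z.1 -> a <= z.2 <= b -> 0 < z.2 /\ 0 < radicand z.
  by case: z => q x /= Oq xab; split; [exact: ab0 xab|exact: OY].
have ck z : O z.1 -> a <= z.2 <= b -> {for z, continuous k}.
  by move=> h1 h2; have [z0 Yz] := Oz z h1 h2; have [? _ _] := dk z z0 Yz; exact: differentiable_continuous.
have ckl z : O z.1 -> a <= z.2 <= b -> {for z, continuous kl}.
  by move=> h1 h2; have [z0 Yz] := Oz z h1 h2; have [_ ? _] := dk z z0 Yz; exact: differentiable_continuous.
have cke z : O z.1 -> a <= z.2 <= b -> {for z, continuous ke}.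
  by move=> h1 h2; have [z0 Yz] := Oz z h1 h2; have [_ _ ?] := dk z z0 Yz; exact: differentiable_continuous.
have dkl (l e x : R) : O (l, e) -> a <= x <= b -> is_derive l 1 (fun l' => k (l', e, x)) (kl (l, e, x)).
  move=> Ole xab; have x0 := ab0 x xab; have Y0 := OY (l, e) x Ole xab.
  have sY : Num.sqrt (radicand (l, e, x)) != 0 by rewrite gt_eqF// sqrtr_gt0.
  have dsY := is_derive_fun_sqrt (f := fun l' => radicand (l', e, x)) Y0 (is_derive_radicand_l l e x).
  rewrite /k /=; eapply is_derive_cast; first by repeat derive_step.
  rewrite /kl /=; set S := Num.sqrt _ in sY *.
  have -> : radicand (l, e, x) = S ^+ 2 by rewrite sqr_sqrtr// ltW.
  have xn0 : x != 0 by rewrite gt_eqF.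
  by field; rewrite sY xn0.
have dke (l e x : R) : O (l, e) -> a <= x <= b -> is_derive e 1 (fun e' => k (l, e', x)) (ke (l, e, x)).
  move=> Ole xab; have x0 := ab0 x xab; have Y0 := OY (l, e) x Ole xab.
  have sY : Num.sqrt (radicand (l, e, x)) != 0 by rewrite gt_eqF// sqrtr_gt0.
  have dsY := is_derive_fun_sqrt (f := fun e' => radicand (l, e', x)) Y0 (is_derive_radicand_e l e x).
  rewrite /k /=; eapply is_derive_cast; first by repeat derive_step.
  rewrite /ke /=; set S := Num.sqrt _ in sY *.
  have -> : radicand (l, e, x) = S ^+ 2 by rewrite sqr_sqrtr// ltW.
  by field; rewrite sY.
pose F (z : R * R * R) : R := \int[lebesgue_measure]_(x in `[a, z.2]) k (z.1, x).
have dF q x : O q -> a < x < b -> differentiable F (q, x).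
  exact: (differentiable_parametric_integral oO ck ckl cke dkl dke).
have dFx q x : O q -> a < x < b -> is_derive x 1 (fun y => F (q, y)) (k (q, x)).
  exact: (is_derive_upper_bound ck).
exists (fun z => F z - F (z.1, rho z.1)).
have rs : a < rho p < b /\ a < s < b.
  by move: am Mb; rewrite lt_min gt_max => /andP[-> ->] /andP[-> ->].
have nab (x : R) : a < x < b -> \forall y \near x, a < y < b.
  move=> xab; have : nbhs x `]a, b[%classic.
    by apply: open_nbhs_nbhs; split; [exact: interval_open|rewrite /= in_itv].
  by apply: filterS => y; rewrite /= in_itv.
have crho : {for p, continuous rho} by apply: differentiable_continuous; exact: Orho.
have n1 : \forall q \near p, O q /\ a < rho q < b.
  have n1a : \forall q \near p, O q by exact: open_nbhs_nbhs.
  have n1b : \forall q \near p, a < rho q < b := crho _ (nab _ rs.1).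
  by apply: filterS2 n1a n1b => q.
have n2 : \forall z \near (p, s), O z.1 /\ a < rho z.1 < b.
  exact: (@near_fst (R * R)%type R (fun q => O q /\ a < rho q < b) (p, s)).
have n3 : \forall z \near (p, s), a < z.2 < b.
  by apply: (@near_snd (R * R)%type R (fun x => a < x < b) (p, s)); exact: nab rs.2.
rewrite /primitive_near; apply: filterS2 n2 n3 => -[q x] /= [Oq rab] xab.
have [x0 Yx] : 0 < x /\ 0 < radicand (q, x).
  by apply: (Oz (q, x)) => //=; move/andP: xab => [/ltW -> /ltW ->].
split => //.
- apply: differentiable_funD; first exact: dF.
  apply: differentiable_funN.
  have drq : differentiable (fun z : R * R * R => (z.1, rho z.1)) (q, x).
    apply: differentiable_pair; first exact: differentiable_fun_fst.
    have dfst : differentiable (fun z : R * R * R => z.1) (q, x).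
      exact: differentiable_fun_fst.
    exact: (@differentiable_comp _ _ _ _ _ rho _ dfst (Orho q Oq)).
  exact: (@differentiable_comp _ _ _ _ _ F _ drq (dF q (rho q) Oq rab)).
- have dk' := dFx q x Oq xab.
  by eapply is_derive_cast; [repeat derive_step|rewrite addr0].
- have ab' y : Num.min (rho q) x <= y <= Num.max (rho q) x -> a < y < b.
    exact: between_itv rab xab.
  have oc y : Num.min (rho q) x < y < Num.max (rho q) x -> a < y < b.
    by move=> /andP[/ltW h1 /ltW h2]; apply: ab'; rewrite h1.
  apply: (@oint_ge0_FTC2 R _ _ _ (fun y => F (q, y))).
  + apply: derivable_within_continuous => y; rewrite in_itv /= => /ab' yab.
    by have [] := dFx q y Oq yab.
  + by move=> y /oc; exact: dFx.
  + move=> y /oc /andP[/ltW ay /ltW yb].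
    have cs : {for y, continuous (fun y : R => (q, y))}.
      by apply: continuous_at_pair; [exact: cvg_cst|exact: cvg_id].
    have ckqy : {for (q, y), continuous k} by apply: ck => //=; rewrite ay.
    exact: (continuous_comp cs ckqy).
  + move=> y /oc /andP[/ltW ay /ltW yb]; rewrite divr_ge0 ?sqrtr_ge0//.
    by rewrite ltW// w0// ab0// ay.
Qed.

End Radicand.

(** * Integration by parts at a turning point *)

Section TurningPoint.
Context {R : realType}.
Variables (U : R -> R) (ueq : R).
Hypothesis hU : smooth_potential U.
Variables (w w1 w2 w3 : R -> R).
Hypotheses (dw : forall x : R, 0 < x -> is_derive x 1 w (w1 x))
  (dw1 : forall x : R, 0 < x -> is_derive x 1 w1 (w2 x))
  (dw2 : forall x : R, 0 < x -> is_derive x 1 w2 (w3 x)).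

Local Notation Y := (radicand U ueq).
Local Notation V := (force U).

(** [V1] and [V2] are the first and second radial derivatives of V. *)
Let V1 (z : R * R * R) : R := derive1n 2 U z.2 + 3 * z.1.1 ^+ 2 * z.2 ^- 4.
Let V2 (z : R * R * R) : R := derive1n 3 U z.2 - 12 * z.1.1 ^+ 2 * z.2 ^- 5.

(* A = - w / V, B = A' / (3 V) and C = - B', derivatives being taken in the
   radius; then (A Y^(1/2) + B Y^(3/2))' = w Y^(-1/2) - C Y^(3/2). *)
Let A (z : R * R * R) : R := - w z.2 * (V z)^-1.
Let B (z : R * R * R) : R :=
  3^-1 * (w z.2 * V1 z * (V z)^-1 ^+ 3 - w1 z.2 * (V z)^-1 ^+ 2).
Let C (z : R * R * R) : R :=
  3^-1 * (w2 z.2 * (V z)^-1 ^+ 2 - (3 * w1 z.2 * V1 z + w z.2 * V2 z) * (V z)^-1 ^+ 3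
          + 3 * w z.2 * V1 z ^+ 2 * (V z)^-1 ^+ 4).

(** The suffix l marks the partial derivative in L. No E-derivatives are needed here, since V, and
    with it C, does not depend on E. *)
Let Vl (z : R * R * R) : R := - 2 * z.1.1 * z.2 ^- 3.
Let V1l (z : R * R * R) : R := 6 * z.1.1 * z.2 ^- 4.
Let V2l (z : R * R * R) : R := - 24 * z.1.1 * z.2 ^- 5.
Let Cl (z : R * R * R) : R :=
  3^-1 * (- 2 * w2 z.2 * (V z)^-1 ^+ 3 * Vl z
     - (3 * w1 z.2 * V1l z + w z.2 * V2l z) * (V z)^-1 ^+ 3
     + 3 * (3 * w1 z.2 * V1 z + w z.2 * V2 z) * (V z)^-1 ^+ 4 * Vl z
     + 6 * w z.2 * V1 z * V1l z * (V z)^-1 ^+ 4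
     - 12 * w z.2 * V1 z ^+ 2 * (V z)^-1 ^+ 5 * Vl z).

(** The remaining integrand and its derivatives in L and E. The latter use (Y^(3/2))' = (3/2)
    Y^(1/2) together with dY/dL = - 2 L x^(-2) and dY/dE = 2. All three are continuous as long as V
    does not vanish, whatever the sign of Y. *)
Let k z : R := C z * (Y z * Num.sqrt (Y z)).
Let kl z : R := Cl z * (Y z * Num.sqrt (Y z))
  - 3 * C z * Num.sqrt (Y z) * (z.1.1 * z.2 ^- 2).
Let ke z : R := 3 * C z * Num.sqrt (Y z).

Let differentiable_derive1n n (z : R * R * R) : 0 < z.2 ->
  differentiable (fun y => derive1n n U y.2) z.
Proof.
move=> z0; apply: differentiable_fun_comp; first exact: hU.
exact: differentiable_fun_snd.
Qed.

Lemma differentiable_force (z : R * R * R) : 0 < z.2 -> differentiable V z.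
Proof.
move=> z0; have z3 : z.2 ^+ 3 != 0 by rewrite expf_neq0// gt_eqF.
have dU := differentiable_derive1n 1 z0.
by rewrite /force; repeat (first [assumption | differentiable_step]).
Qed.

Lemma is_derive_force (l e x : R) : 0 < x ->
  is_derive x 1 (fun y => V (l, e, y)) (V1 (l, e, x)).
Proof.
move=> x0; have xn0 : x != 0 by rewrite gt_eqF.
have x3 : x ^+ 3 != 0 by rewrite expf_neq0.
have dU := is_derive_potential hU 1 x0.
rewrite /force /=; eapply is_derive_cast; first by repeat derive_step.
by rewrite /V1 /=; field.
Qed.

Let is_derive_force1 (l e x : R) : 0 < x ->
  is_derive x 1 (fun y => V1 (l, e, y)) (V2 (l, e, x)).
Proof.
move=> x0; have xn0 : x != 0 by rewrite gt_eqF.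
have x4 : x ^+ 4 != 0 by rewrite expf_neq0.
have dU := is_derive_potential hU 2 x0.
rewrite /V1 [X in is_derive _ _ X _]/=; eapply is_derive_cast; first by repeat derive_step.
by rewrite /V2 /=; field.
Qed.

Let is_derive_force_l (l e x : R) : is_derive l 1 (fun l' => V (l', e, x)) (Vl (l, e, x)).
Proof.
rewrite /force /=; eapply is_derive_cast; first by repeat derive_step.
by rewrite /Vl /=; ring.
Qed.

Let is_derive_force1_l (l e x : R) : is_derive l 1 (fun l' => V1 (l', e, x)) (V1l (l, e, x)).
Proof.
rewrite /V1 [X in is_derive _ _ X _]/=; eapply is_derive_cast; first by repeat derive_step.
by rewrite /V1l /=; ring.
Qed.

Let is_derive_force2_l (l e x : R) : is_derive l 1 (fun l' => V2 (l', e, x)) (V2l (l, e, x)).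
Proof.
rewrite /V2 [X in is_derive _ _ X _]/=; eapply is_derive_cast; first by repeat derive_step.
by rewrite /V2l /=; ring.
Qed.

Let is_derive_C_l (l e x : R) : V (l, e, x) != 0 ->
  is_derive l 1 (fun l' => C (l', e, x)) (Cl (l, e, x)).
Proof.
move=> V0; have dV := is_derive_force_l l e x.
have dV1 := is_derive_force1_l l e x; have dV2 := is_derive_force2_l l e x.
rewrite /C /=; eapply is_derive_cast; first by repeat derive_step.
rewrite /Cl /=; set v := V _ in V0 *; set v1 := V1 _; set v2 := V2 _.
set vl := Vl _; set v1l := V1l _; set v2l := V2l _.
by field.
Qed.

Let differentiable_coef (z : R * R * R) : 0 < z.2 -> V z != 0 ->
  [/\ differentiable A z, differentiable B z, differentiable C z & differentiable Cl z].
Proof.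
move=> z0 V0.
have zn0 : z.2 != 0 by rewrite gt_eqF.
have [z3 z4 z5] : [/\ z.2 ^+ 3 != 0, z.2 ^+ 4 != 0 & z.2 ^+ 5 != 0].
  by split; exact: expf_neq0.
have dV := differentiable_force z0.
have dwc (g g' : R -> R) : (forall x : R, 0 < x -> is_derive x 1 g (g' x)) ->
    differentiable (fun y : R * R * R => g y.2) z.
  move=> dg; apply: differentiable_fun_comp; first by have [] := dg _ z0.
  exact: differentiable_fun_snd.
have dW := dwc _ _ dw; have dW1 := dwc _ _ dw1; have dW2 := dwc _ _ dw2.
have dV1 : differentiable V1 z.
  have dU := differentiable_derive1n 2 z0.
  by rewrite /V1; repeat (first [assumption | differentiable_step]).
have dV2 : differentiable V2 z.
  have dU := differentiable_derive1n 3 z0.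
  by rewrite /V2; repeat (first [assumption | differentiable_step]).
have dVl : differentiable Vl z by rewrite /Vl; repeat (first [assumption | differentiable_step]).
have dV1l : differentiable V1l z by rewrite /V1l; repeat (first [assumption | differentiable_step]).
have dV2l : differentiable V2l z by rewrite /V2l; repeat (first [assumption | differentiable_step]).
by split; rewrite /A /B /C /Cl; repeat (first [assumption | differentiable_step]).
Qed.

Let is_derive_AB (l e x : R) : 0 < x -> V (l, e, x) != 0 -> 0 < Y (l, e, x) ->
  is_derive x 1 (fun y => A (l, e, y) * Num.sqrt (Y (l, e, y))
      + B (l, e, y) * (Y (l, e, y) * Num.sqrt (Y (l, e, y))))
    (w x / Num.sqrt (Y (l, e, x)) - k (l, e, x)).
Proof.
move=> x0 V0 Y0; have dV := is_derive_force l e x0; have dV1 := is_derive_force1 l e x0.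
have dY := is_derive_radicand ueq hU l e x0.
have S0 : Num.sqrt (Y (l, e, x)) != 0 by rewrite gt_eqF// sqrtr_gt0.
have dS := is_derive_fun_sqrt (f := fun y => Y (l, e, y)) Y0 dY.
have dwx := dw x0; have dw1x := dw1 x0.
rewrite /A /B /=; eapply is_derive_cast; first by repeat derive_step.
rewrite /k /C /=; set v := V _ in V0 *; set v1 := V1 _; set v2 := V2 _.
set S := Num.sqrt _ in S0 *.
have -> : Y (l, e, x) = S ^+ 2 by rewrite sqr_sqrtr// ltW.
by field; rewrite V0 S0.
Qed.

Let is_derive_k_l (l e x : R) : V (l, e, x) != 0 ->
  is_derive l 1 (fun l' => k (l', e, x)) (kl (l, e, x)).
Proof.
move=> V0; have dC := is_derive_C_l V0.
have dY := is_derive_radicand_l U ueq l e x.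
have dS := is_derive_fun_comp (f := fun l' => Y (l', e, x)) (is_derive_mul_sqrt _) dY.
rewrite /k; eapply is_derive_cast; first by repeat derive_step.
by rewrite /kl /=; set xi := x ^- 2; field.
Qed.

Let is_derive_k_e (l e x : R) : is_derive e 1 (fun e' => k (l, e', x)) (ke (l, e, x)).
Proof.
have dY := is_derive_radicand_e U ueq l e x.
have dS := is_derive_fun_comp (f := fun e' => Y (l, e', x)) (is_derive_mul_sqrt _) dY.
have dC : is_derive e 1 (fun e' => C (l, e', x)) 0.
  exact: (is_derive_fun_const (C (l, e, x)) e).
rewrite /k; eapply is_derive_cast; first by repeat derive_step.
by rewrite /ke /=; field.
Qed.

Let continuous_k (z : R * R * R) : 0 < z.2 -> V z != 0 ->
  [/\ {for z, continuous k}, {for z, continuous kl} & {for z, continuous ke}].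
Proof.
move=> z0 V0; have [_ _ dC dCl] := differentiable_coef z0 V0.
have cC := differentiable_continuous dC; have cCl := differentiable_continuous dCl.
have cY : {for z, continuous Y} by exact: continuous_radicand.
have cS : {for z, continuous (fun y => Num.sqrt (Y y))}.
  exact: (continuous_comp cY (@sqrt_continuous R _)).
have cx : {for z, continuous (fun y : R * R * R => y.1.1 * y.2 ^- 2)}.
  apply: differentiable_continuous; repeat differentiable_step.
  by rewrite sqrf_eq0 gt_eqF.
have c3 : {for z, continuous (fun y : R * R * R => 3 : R)} by exact: cvg_cst.
split; rewrite /k /kl /ke; repeat (first [assumption | apply: cvgM | apply: cvgB]).
Qed.

(** On a segment around rho(p) where V has no zero, P + F is a radial antiderivative of w Y^(-1/2),
    with P the boundary terms and F the integral of [k] from a fixed a. At rho(q) the terms in P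
    vanish with Y, for every nearby q, so differentiability of P is needed only at radii where Y >
    0. *)
Lemma primitive_near_turning (rho : R * R -> R) (p : R * R) :
  (forall x : R, 0 < x -> 0 <= w x) ->
  0 < rho p -> V (p, rho p) != 0 ->
  (\forall q \near p, differentiable rho q /\ Y (q, rho q) = 0) ->
  \forall c \near rho p, 0 < Y (p, c) -> exists G, primitive_near U ueq w rho p c G.
Proof.
move=> w0 rp0 Vp nrho; pose sg := V (p, rho p).
have sg2 : 0 < V (p, rho p) * sg by rewrite -expr2 exprn_even_gt0.
have nV z : 0 < z.2 -> 0 < V z * sg -> \forall y \near z, 0 < y.2 /\ 0 < V y * sg.
  move=> z0 Vz; have cV : {for z, continuous V}.
    exact/differentiable_continuous/differentiable_force.
  have cVs : {for z, continuous (fun y => V y * sg)} by apply: cvgM => //; exact: cvg_cst.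
  have n1 : \forall y \near z, 0 < V y * sg by have /cvgr_gt := cVs; apply.
  have n2 : \forall y \near z, 0 < y.2.
    by apply: (@near_snd (R * R)%type R (fun x => 0 < x) z); exact: lt_nbhsr.
  by apply: filterS2 n2 n1.
have [a [b [arp rpb abV]]] : exists a b, [/\ a < rho p, rho p < b &
    forall x, a <= x <= b -> 0 < x /\ 0 < V (p, x) * sg].
  apply: widen_segment => // [x [x0 Vx]|x].
    have cs : {for x, continuous (fun y : R => (p, y))}.
      by apply: continuous_at_pair; [exact: cvg_cst|exact: cvg_id].
    exact: (cs _ (nV (p, x) x0 Vx)).
  by move=> h; have -> : x = rho p by lra.
have nO1 : \forall q \near p, forall x, a <= x <= b -> 0 < V (q, x) * sg.
  apply: (near_segment (P := fun z => 0 < V z * sg)) => x xab.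
  have [x0 Vx] := abV x xab.
  by apply: filterS (nV (p, x) x0 Vx) => y [].
pose O : set (R * R) := interior ([set q | forall x, a <= x <= b -> 0 < V (q, x) * sg]
  `&` [set q | differentiable rho q /\ Y (q, rho q) = 0]).
have oO : open O by exact: open_interior.
have Op : O p by exact: filterI nO1 nrho.
have OV q x : O q -> a <= x <= b -> 0 < V (q, x) * sg.
  by move=> /interior_subset[+ _]; exact.
have Orho q : O q -> differentiable rho q by move=> /interior_subset[_ []].
have OY0 q : O q -> Y (q, rho q) = 0 by move=> /interior_subset[_ []].
have ab0 x : a <= x <= b -> 0 < x by move=> /abV[].
have OV0 q x : O q -> a <= x <= b -> V (q, x) != 0.
  move=> Oq xab; have := OV q x Oq xab; apply: contraTneq => ->.
  by rewrite mul0r ltxx.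
have Oz z : O z.1 -> a <= z.2 <= b -> 0 < z.2 /\ V z != 0.
  by case: z => q x /= Oq xab; split; [exact: ab0 xab|exact: OV0].
have ck z : O z.1 -> a <= z.2 <= b -> {for z, continuous k}.
  by move=> h1 h2; have [z0 Vz] := Oz z h1 h2; have [] := continuous_k z0 Vz.
have ckl z : O z.1 -> a <= z.2 <= b -> {for z, continuous kl}.
  by move=> h1 h2; have [z0 Vz] := Oz z h1 h2; have [] := continuous_k z0 Vz.
have cke z : O z.1 -> a <= z.2 <= b -> {for z, continuous ke}.
  by move=> h1 h2; have [z0 Vz] := Oz z h1 h2; have [] := continuous_k z0 Vz.
have dkl l e x : O (l, e) -> a <= x <= b -> is_derive l 1 (fun l' => k (l', e, x)) (kl (l, e, x)).
  by move=> Ole xab; apply: is_derive_k_l; exact: OV0.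
have dke l e x : O (l, e) -> a <= x <= b -> is_derive e 1 (fun e' => k (l, e', x)) (ke (l, e, x)).
  by move=> _ _; exact: is_derive_k_e.
pose F (z : R * R * R) : R := \int[lebesgue_measure]_(x in `[a, z.2]) k (z.1, x).
have dF q x : O q -> a < x < b -> differentiable F (q, x).
  exact: (differentiable_parametric_integral oO ck ckl cke dkl dke).
have dFx q x : O q -> a < x < b -> is_derive x 1 (fun y => F (q, y)) (k (q, x)).
  exact: (is_derive_upper_bound ck).
have nab (x : R) : a < x < b -> \forall y \near x, a < y < b.
  move=> xab; have : nbhs x `]a, b[%classic.
    by apply: open_nbhs_nbhs; split; [exact: interval_open|rewrite /= in_itv].
  by apply: filterS => y; rewrite /= in_itv.
have rab : a < rho p < b by rewrite arp.
apply: filterS (nab _ rab) => c cab Yc.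
pose P (z : R * R * R) : R := A z * Num.sqrt (Y z) + B z * (Y z * Num.sqrt (Y z)).
exists (fun z => P z + F z - F (z.1, rho z.1)).
have crho : {for p, continuous rho} by apply: differentiable_continuous; exact: Orho.
have n1 : \forall q \near p, O q /\ a < rho q < b.
  have n1a : \forall q \near p, O q by exact: open_nbhs_nbhs.
  have n1b : \forall q \near p, a < rho q < b := crho _ (nab _ rab).
  by apply: filterS2 n1a n1b => q.
have n2 : \forall z \near (p, c), O z.1 /\ a < rho z.1 < b.
  exact: (@near_fst (R * R)%type R (fun q => O q /\ a < rho q < b) (p, c)).
have n3 : \forall z \near (p, c), a < z.2 < b /\ (0 < z.2 /\ 0 < Y z).
  have n3a : \forall z \near (p, c), a < z.2 < b.
    by apply: (@near_snd (R * R)%type R (fun x => a < x < b) (p, c)); exact: nab cab.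
  have c0 : 0 < (p, c).2 by apply: ab0; move/andP: cab => [/ltW -> /ltW ->].
  by apply: filterS2 n3a (near_radicand_gt0 hU c0 Yc) => z.
rewrite /primitive_near; apply: filterS2 n2 n3 => -[[l e] x] /= [Oq rqab] [xab [x0 Yx]].
have xab' : a <= x <= b by move/andP: xab => [/ltW -> /ltW ->].
have Vx := OV0 _ x Oq xab'.
have [dA dB _ _] := differentiable_coef (z := (l, e, x)) x0 Vx.
have dY := differentiable_radicand ueq hU (z := (l, e, x)) x0.
have ab' y : Num.min (rho (l, e)) x <= y <= Num.max (rho (l, e)) x -> a < y < b.
  exact: between_itv rqab xab.
split => //.
- have dS : differentiable (fun y => Num.sqrt (Y y)) (l, e, x).
    by apply: differentiable_fun_comp => //; have [] := is_derive1_sqrt Yx.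
  have drq : differentiable (fun z : R * R * R => (z.1, rho z.1)) (l, e, x).
    apply: differentiable_pair; first exact: differentiable_fun_fst.
    have dfst : differentiable (fun z : R * R * R => z.1) (l, e, x).
      exact: differentiable_fun_fst.
    exact: (@differentiable_comp _ _ _ _ _ rho _ dfst (Orho _ Oq)).
  have dFr := @differentiable_comp _ _ _ _ _ F _ drq (dF _ (rho (l, e)) Oq rqab).
  have dFz := dF _ x Oq xab.
  apply: differentiable_funD; last exact: differentiable_funN.
  by rewrite /P; repeat (first [assumption | differentiable_step]).
- have dP := is_derive_AB x0 Vx Yx; have dk := dFx _ x Oq xab.
  have dc := is_derive_fun_const (- F (l, e, rho (l, e))) x.
  apply: (is_derive_cast (is_derive_funD (is_derive_funD dP dk) dc)).
  by rewrite addr0 subrK.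
- have Yr := OY0 _ Oq.
  (* The missing term P at rho is 0; inserting it gives the difference of the antiderivative at the
     two ends. *)
  have -> : P (l, e, x) + F (l, e, x) - F (l, e, rho (l, e)) =
      (P (l, e, x) + F (l, e, x)) - (P (l, e, rho (l, e)) + F (l, e, rho (l, e))).
    by rewrite {3}/P Yr sqrtr0 !mulr0 !(addr0, add0r).
  (* Y starts at 0 at rho and is strictly monotone, because V keeps its sign; being positive at x,
     it is positive strictly between. *)
  have Ypos y : Num.min (rho (l, e)) x < y < Num.max (rho (l, e)) x -> 0 < Y (l, e, y).
    move=> yrx; have dYt t : a < t < b ->
        is_derive t 1 (fun y => Y (l, e, y)) (- 2 * V (l, e, t)).
      by move=> /andP[/ltW h1 /ltW h2]; apply: is_derive_radicand => //; apply: ab0; rewrite h1.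
    have [t1 tI1 E1] := MVT_between (fun t h => dYt t (ab' t h)).
    have yI t : Num.min (rho (l, e)) y <= t <= Num.max (rho (l, e)) y -> a < t < b.
      move=> tI; apply: ab'; apply: between_trans tI.
      by move/andP: yrx => [/ltW -> /ltW ->].
    have [t2 tI2 E2] := MVT_between (fun t h => dYt t (yI t h)).
    have {tI1} V1s : 0 < V (l, e, t1) * sg.
      by apply: OV => //; have /andP[/ltW -> /ltW ->] := ab' _ tI1.
    have {tI2} V2s : 0 < V (l, e, t2) * sg.
      by apply: OV => //; have /andP[/ltW -> /ltW ->] := yI _ tI2.
    rewrite Yr !subr0 in E1 E2.
    rewrite E2; rewrite E1 in Yx.
    exact: same_sign_gt0 V1s V2s Yx yrx.
  have oc y : Num.min (rho (l, e)) x < y < Num.max (rho (l, e)) x -> a < y < b.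
    by move=> /andP[/ltW h1 /ltW h2]; apply: ab'; rewrite h1.
  apply: (@oint_ge0_FTC2 R _ _ _ (fun y => P (l, e, y) + F (l, e, y))).
  + apply: continuous_in_subspaceT => y; rewrite inE /= in_itv /= => /ab' yab.
    have yab' : a <= y <= b by move/andP: yab => [/ltW -> /ltW ->].
    have y0 := ab0 _ yab'; have Vy := OV0 _ y Oq yab'.
    have [dAy dBy _ _] := differentiable_coef (z := (l, e, y)) y0 Vy.
    have cs : {for y, continuous (fun t : R => (l, e, t))}.
      by apply: continuous_at_pair; [exact: cvg_cst|exact: cvg_id].
    have cA := continuous_comp cs (differentiable_continuous dAy).
    have cB := continuous_comp cs (differentiable_continuous dBy).
    have cY := continuous_comp cs (@continuous_radicand R U ueq hU (l, e, y) y0).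
    have cS := continuous_comp cY (@sqrt_continuous R _).
    have [/derivable1_diffP/differentiable_continuous cF _] := dFx _ y Oq yab.
    rewrite /P; apply: cvgD => //; apply: cvgD; first exact: cvgM.
    by apply: cvgM => //; exact: cvgM.
  + move=> y yrx; have yab := oc _ yrx.
    have yab' : a <= y <= b by move/andP: yab => [/ltW -> /ltW ->].
    have dPy := is_derive_AB (ab0 _ yab') (OV0 _ y Oq yab') (Ypos _ yrx).
    by apply: (is_derive_cast (is_derive_funD dPy (dFx _ y Oq yab))); rewrite subrK.
  + move=> y yrx; have yab := oc _ yrx; have Yy := Ypos _ yrx.
    have yab' : a <= y <= b by move/andP: yab => [/ltW -> /ltW ->].
    have y0 := ab0 _ yab'.
    have cs : {for y, continuous (fun t : R => (l, e, t))}.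
      by apply: continuous_at_pair; [exact: cvg_cst|exact: cvg_id].
    have cY := continuous_comp cs (@continuous_radicand R U ueq hU (l, e, y) y0).
    have cS := continuous_comp cY (@sqrt_continuous R _).
    have cw : {for y, continuous w}.
      by have [/derivable1_diffP/differentiable_continuous] := dw y0.
    apply: cvgM => //; apply: cvgV => //.
    by rewrite gt_eqF// sqrtr_gt0.
  + move=> y yrx; have yab := oc _ yrx; rewrite divr_ge0 ?sqrtr_ge0// w0//.
    by apply: ab0; move/andP: yab => [/ltW -> /ltW ->].
Qed.

End TurningPoint.

(** * Gluing the two kinds of primitives *)

Lemma between_shrink (R : realType) (r s c x : R) : Num.min r s < c < Num.max r s ->
  Num.min c s <= x <= Num.max c s -> x != s -> Num.min r s < x < Num.max r s.
Proof.
move=> h1 h2 /eqP h3.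
by case: (ltgtP r s) h1 => rs h1; case: (ltgtP c s) h2 => cs h2; apply/andP; split;
  rewrite ?lt_neqAle; try (apply/andP; split; first apply/eqP); lra.
Qed.

Section PrimitiveExists.
Context {R : realType}.
Variables (U : R -> R) (ueq : R).
Hypothesis hU : smooth_potential U.

Local Notation Y := (radicand U ueq).
Local Notation V := (force U).

(** The cut c stays fixed while (L, E) and the radius vary. Being strictly between the two ends at
    p, it stays between them nearby, so the two integrals add up on a whole neighbourhood. *)
Lemma primitive_near_cat (w : R -> R) (rho : R * R -> R) (p : R * R) (c s : R) G1 G2 :
  {for p, continuous rho} -> Num.min (rho p) s < c < Num.max (rho p) s ->
  primitive_near U ueq w rho p c G1 -> primitive_near U ueq w (fun=> c) p s G2 ->
  primitive_near U ueq w rho p s (fun z => G1 (z.1, c) + G2 z).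
Proof.
move=> crho crs nG1 nG2.
have cs : {for p, continuous (fun q : R * R => (q, c))}.
  by apply: continuous_at_pair; [exact: cvg_id|exact: cvg_cst].
have n1 := cs _ nG1.
have n2 := @near_fst (R * R)%type R _ (p, s) n1.
have n3 : \forall z \near (p, s), Num.min (rho z.1) z.2 <= c <= Num.max (rho z.1) z.2.
  have lt1 (d : R) : rho p < d -> \forall z \near (p, s), rho z.1 < d.
    move=> h; apply: (@near_fst (R * R)%type R (fun q => rho q < d) (p, s)).
    by have /cvgr_lt := crho; apply.
  have gt1 (d : R) : d < rho p -> \forall z \near (p, s), d < rho z.1.
    move=> h; apply: (@near_fst (R * R)%type R (fun q => d < rho q) (p, s)).
    by have /cvgr_gt := crho; apply.
  have lt2 (d : R) : s < d -> \forall z \near (p, s), z.2 < d.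
    move=> h; apply: (@near_snd (R * R)%type R (fun q => q < d) (p, s)).
    exact: lt_nbhsl.
  have gt2 (d : R) : d < s -> \forall z \near (p, s), d < z.2.
    move=> h; apply: (@near_snd (R * R)%type R (fun q => d < q) (p, s)).
    exact: lt_nbhsr.
  case: (ltgtP (rho p) s) crs => rs /andP[h1 h2]; last by have := lt_trans h1 h2; rewrite rs ltxx.
  - by apply: filterS2 (lt1 _ h1) (gt2 _ h2) => z /ltW k1 /ltW k2; rewrite ge_min le_max k1 k2 orbT.
  - by apply: filterS2 (gt1 _ h2) (lt2 _ h1) => z /ltW k1 /ltW k2; rewrite ge_min le_max k1 k2 orbT.
rewrite /primitive_near; apply: filterS3 n2 nG2 n3 => z /= [dG1 _ _ _ oi1] [dG2 z0 Yz dxG2 oi2] zc.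
split => //.
- apply: differentiable_funD => //.
  have dq : differentiable (fun y : R * R * R => (y.1, c)) z.
    by apply: differentiable_pair; [exact: differentiable_fun_fst|exact: differentiable_fun_const].
  exact: (@differentiable_comp _ _ _ _ _ G1 _ dq dG1).
- apply: (is_derive_cast (is_derive_funD (is_derive_fun_const (G1 (z.1, c)) z.2) dxG2)).
  exact: add0r.
- exact: oint_cat zc oi1 oi2.
Qed.

(** If Y is positive at rho(p) the whole segment is regular. Otherwise the segment is cut at a
    radius c close to rho(p): the turning-point argument covers the piece up to c, and the regular
    one the piece from c to s. *)
Lemma exists_primitive_near (w w1 w2 w3 : R -> R) (rho : R * R -> R) (p : R * R) (s : R) :
  (forall x : R, 0 < x -> is_derive x 1 w (w1 x)) ->
  (forall x : R, 0 < x -> is_derive x 1 w1 (w2 x)) ->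
  (forall x : R, 0 < x -> is_derive x 1 w2 (w3 x)) ->
  (forall x : R, 0 < x -> 0 < w x) ->
  (\forall q \near p, differentiable rho q /\ (Y (q, rho q) = 0 \/ V (q, rho q) = 0)) ->
  0 < rho p -> 0 < s -> 0 < Y (p, s) ->
  (forall x, Num.min (rho p) s < x < Num.max (rho p) s -> 0 < Y (p, x)) ->
  (0 < Y (p, rho p) \/ Y (p, rho p) = 0 /\ V (p, rho p) != 0) ->
  exists G, primitive_near U ueq w rho p s G.
Proof.
move=> dw dw1 dw2 w0 nrho rp0 s0 Ys Yrs Yr.
have drho : \forall q \near p, differentiable rho q by apply: filterS nrho => q [].
have crho : {for p, continuous rho} by apply/differentiable_continuous/(nbhs_singleton drho).
case: Yr => [Yr|[Yr Vr]].
  apply: (primitive_near_regular hU dw w0 drho) => x xrs.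
  have x0 : 0 < x by case/andP: xrs => h _; apply: lt_le_trans h; rewrite lt_min rp0.
  split=> //; case: (eqVneq x (rho p)) => [->//|xr]; case: (eqVneq x s) => [->//|xs].
  apply: Yrs; move: xrs xr xs; case: (ltgtP (rho p) s) => rs /andP[h1 h2] xr xs.
  - by rewrite !lt_neqAle h1 h2 xs eq_sym xr.
  - by rewrite !lt_neqAle h1 h2 xr eq_sym xs.
  - by case/eqP: xr; lra.
have rsn : rho p != s by apply: contraTneq Ys => <-; rewrite Yr ltxx.
(* Since V does not vanish at the turning point, nearby points of the branch cannot be inertial, so
   they are turning points as well. *)
have nturn : \forall q \near p, differentiable rho q /\ Y (q, rho q) = 0.
  have cV : {for p, continuous (fun q => V (q, rho q))}.
    have cq : {for p, continuous (fun q => (q, rho q))}.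
      by apply: continuous_at_pair => //; exact: cvg_id.
    have cV := differentiable_continuous (differentiable_force hU (z := (p, rho p)) rp0).
    exact: (continuous_comp cq cV).
  have nV : \forall q \near p, V (q, rho q) != 0.
    by have /cvgr_neq0 := cV; apply.
  by apply: filterS2 nrho nV => q [dq [->//|->]]; rewrite eqxx.
have w0' x : 0 < x -> 0 <= w x by move=> /w0/ltW.
have nc := primitive_near_turning hU dw dw1 dw2 w0' rp0 Vr nturn.
have [d /= d0 dP] := (nbhs_ballP _ _).1 nc.
(* The first bound keeps c in the ball where the turning-point argument applies, the second keeps it
   strictly between rho(p) and s. *)
pose h := Num.min (d / 2) (`|s - rho p| / 2).
have sr0 : 0 < `|s - rho p| by rewrite normr_gt0 subr_eq0 eq_sym.
have h0 : 0 < h by rewrite lt_min !divr_gt0.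
have hd : h <= d / 2 by rewrite ge_min lexx.
have hs : h <= `|s - rho p| / 2 by rewrite ge_min lexx orbT.
have [c [crs dc]] : exists c, Num.min (rho p) s < c < Num.max (rho p) s /\ ball (rho p) d c.
  exists (if rho p < s then rho p + h else rho p - h); move: rsn.
  case: (ltgtP (rho p) s) => // rs _.
  - rewrite (gtr0_norm (x := s - rho p)) ?subr_gt0// in hs.
    split; first by lra.
    by rewrite -ball_normE /= opprD addNKr normrN gtr0_norm//; lra.
  - rewrite (ltr0_norm (x := s - rho p)) ?subr_lt0// in hs.
    split; first by lra.
    by rewrite -ball_normE /= opprB addrC subrK gtr0_norm//; lra.
have Yc := Yrs _ crs.
have [G1 G1P] := dP _ dc Yc.
have [G2 G2P] : exists G, primitive_near U ueq w (fun=> c) p s G.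
  apply: (primitive_near_regular hU dw w0) => [|x xcs].
    by apply: filterS drho => q _; exact: differentiable_fun_const.
  have c0 : 0 < c by case/andP: crs => k _; apply: lt_trans k; rewrite lt_min rp0.
  have x0 : 0 < x by case/andP: xcs => k _; apply: lt_le_trans k; rewrite lt_min c0.
  split=> //; case: (eqVneq x s) => [->//|xs].
  exact: Yrs (between_shrink crs xcs xs).
by exists (fun z => G1 (z.1, c) + G2 z); exact: primitive_near_cat crho crs G1P G2P.
Qed.

End PrimitiveExists.

(** * The equations of motion *)

Section EquationsOfMotion.
Context {R : realType}.
Variables (U : R -> R) (ueq : R).
Hypothesis hU : smooth_potential U.

(** Time is one of the coordinates and flows at speed 1, so explicit time dependence needs no
    separate treatment: dI/dt is the differential of I on this vector. *)
Definition vector_field (p : phase R) : phase R :=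
  (1, vel p, angvel p, angvel p ^+ 2 * rcoord p - derive1 U (rcoord p),
   - (2 * angvel p * vel p / rcoord p)).

Lemma diff_phase (I : phase R -> R) (p : phase R) (a b c d e : R) : differentiable I p ->
  'd I p (a, b, c, d, e) = a * 'D_((1, 0, 0, 0, 0) : phase R) I p
    + b * 'D_((0, 1, 0, 0, 0) : phase R) I p + c * 'D_((0, 0, 1, 0, 0) : phase R) I p
    + d * 'D_((0, 0, 0, 1, 0) : phase R) I p + e * 'D_((0, 0, 0, 0, 1) : phase R) I p.
Proof.
move=> dI; rewrite !deriveE//.
have -> : (a, b, c, d, e) = a *: ((1, 0, 0, 0, 0) : phase R) + b *: ((0, 1, 0, 0, 0) : phase R)
   + c *: ((0, 0, 1, 0, 0) : phase R) + d *: ((0, 0, 0, 1, 0) : phase R)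
   + e *: ((0, 0, 0, 0, 1) : phase R).
  transitivity (a * 1 + b * 0 + c * 0 + d * 0 + e * 0, a * 0 + b * 1 + c * 0 + d * 0 + e * 0,
    a * 0 + b * 0 + c * 1 + d * 0 + e * 0, a * 0 + b * 0 + c * 0 + d * 1 + e * 0,
    a * 0 + b * 0 + c * 0 + d * 0 + e * 1); last by [].
  by rewrite !(mulr0, mulr1, addr0, add0r).
by rewrite !linearD !linearZ.
Qed.

Lemma first_integralP (D : set (phase R)) (I : phase R -> R) :
  first_integral_on U D I <->
  forall p, D p -> differentiable I p /\ 'd I p (vector_field p) = 0.
Proof.
split=> h p /h[dI E]; split=> //; move: E; rewrite diff_phase// mul1r mulNr //.
Qed.

(** Reduces a differential on the five-dimensional phase space to a one-variable derivative at 0,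
    computed by the rules for functions of one variable. *)
Lemma diff_along_line (I : phase R -> R) (p x : phase R) (c : R) : differentiable I p ->
  is_derive (0 : R) 1 (fun h : R => I (p.1.1.1.1 + h * x.1.1.1.1, p.1.1.1.2 + h * x.1.1.1.2,
    p.1.1.2 + h * x.1.1.2, p.1.2 + h * x.1.2, p.2 + h * x.2)) c ->
  'd I p x = c.
Proof.
move=> dI dc.
have line (a b : R) : is_derive (0 : R) 1 (fun h : R => a + h * b) b.
  by eapply is_derive_cast; [repeat derive_step|rewrite /=; ring].
pose g (h : R) : phase R := (p.1.1.1.1 + h * x.1.1.1.1, p.1.1.1.2 + h * x.1.1.1.2,
    p.1.1.2 + h * x.1.1.2, p.1.2 + h * x.1.2, p.2 + h * x.2).
have g0 : g 0 = p by rewrite /g !mul0r !addr0; case: p {dI dc g} => [[[[? ?] ?] ?] ?].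
have dg : is_derive (0 : R) 1 g x.
  have -> : x = (x.1.1.1.1, x.1.1.1.2, x.1.1.2, x.1.2, x.2) by case: x {dc g g0} => [[[[? ?] ?] ?] ?].
  by do 4 apply: is_derive_pair => //.
have dIg : differentiable I (g 0) by rewrite g0.
have [_ E1] := is_derive_diff_comp dg dIg; have [_ E2] := dc.
by rewrite g0 in E1; exact: etrans (esym E1) E2.
Qed.

Lemma differentiable_angmom (p : phase R) : differentiable (@angmom R) p.
Proof. by rewrite /angmom /angvel /rcoord; repeat differentiable_step. Qed.

Lemma diff_angmom (p x : phase R) : 'd (@angmom R) p x =
  x.2 * rcoord p ^+ 2 + 2 * angvel p * rcoord p * x.1.1.1.2.
Proof.
apply: diff_along_line; first exact: differentiable_angmom.
rewrite /angmom /angvel /rcoord /=.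
by eapply is_derive_cast; [repeat derive_step|rewrite /=; ring].
Qed.

Lemma differentiable_energy (p : phase R) : 0 < rcoord p -> differentiable (energy U ueq) p.
Proof.
move=> p0; have dL := differentiable_angmom p.
have dr : differentiable (fun q : phase R => q.1.1.1.2) p by repeat differentiable_step.
have dUr : differentiable (fun q : phase R => U q.1.1.1.2) p.
  by apply: differentiable_fun_comp => //; exact: (@hU 0).
rewrite /energy /rcoord /vel; repeat (first [assumption | differentiable_step]).
by rewrite sqrf_eq0 gt_eqF.
Qed.

Lemma diff_energy (p x : phase R) : 0 < rcoord p -> 'd (energy U ueq) p x =
  vel p * x.1.2 + angvel p * rcoord p ^+ 2 * x.2
  + (angvel p ^+ 2 * rcoord p + derive1 U (rcoord p)) * x.1.1.1.2.
Proof.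
move=> p0; apply: diff_along_line; first exact: differentiable_energy.
move: p0; rewrite /energy /angmom /angvel /rcoord /vel /= => p0.
have r0 : p.1.1.1.2 != 0 by rewrite gt_eqF.
have dU := is_derive_potential hU 0 p0.
have dr : is_derive (0 : R) 1 (fun h : R => p.1.1.1.2 + h * x.1.1.1.2) x.1.1.1.2.
  by eapply is_derive_cast; [repeat derive_step|rewrite /=; ring].
have dUr : is_derive (0 : R) 1 (fun h : R => U (p.1.1.1.2 + h * x.1.1.1.2))
    (derive1 U p.1.1.1.2 * x.1.1.1.2).
  by apply: is_derive_fun_comp dr; rewrite mul0r addr0.
have r20 : (p.1.1.1.2 + 0 * x.1.1.1.2) ^+ 2 != 0 by rewrite mul0r addr0 sqrf_eq0.
eapply is_derive_cast; first by repeat derive_step.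
by rewrite /= !mul0r !addr0; field.
Qed.

Lemma first_integral_angmom : first_integral_on U phase_space (@angmom R).
Proof.
apply/first_integralP => p p0; split; first exact: differentiable_angmom.
have r0 : rcoord p != 0 by rewrite gt_eqF.
by rewrite diff_angmom /vector_field /=; field.
Qed.

Lemma first_integral_energy : first_integral_on U phase_space (energy U ueq).
Proof.
apply/first_integralP => p p0; split; first exact: differentiable_energy.
have r0 : rcoord p != 0 by rewrite gt_eqF.
by rewrite diff_energy// /vector_field /=; field.
Qed.

(** The energy equation solved for v^2. Together with conservation of L and E it is the only source
    of sign information on Y along a trajectory. *)
Lemma radicand_energy (p : phase R) : radicand U ueq (angmom p, energy U ueq p, rcoord p) = vel p ^+ 2.
Proof.
by rewrite /radicand /time_radicand /= /energy; set i := (rcoord p ^+ 2)^-1; field.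
Qed.

Section Solution.
Variables (J : set R) (r th : R -> R).
Hypothesis sol : solution U J r th.

Lemma is_derive_state t : J t ->
  is_derive t 1 (state r th) (vector_field (state r th t)).
Proof.
move=> Jt; have [_ _ /(_ t Jt)[r0 dr dth ddr ddth]] := sol.
rewrite /state /vector_field /vel /angvel /rcoord /=.
apply: is_derive_pair; last by apply: (is_derive_cast ddth); ring.
apply: is_derive_pair.
apply: is_derive_pair; last by rewrite derive1E; exact: derivableP.
apply: is_derive_pair; last by rewrite derive1E; exact: derivableP.
Qed.

Lemma first_integral_along_solution (D : set (phase R)) (I : phase R -> R) t1 t2 :
  first_integral_on U D I -> J t1 -> J t2 ->
  (forall t, Num.min t1 t2 <= t <= Num.max t1 t2 -> D (state r th t)) ->
  I (state r th t1) = I (state r th t2).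
Proof.
move=> /first_integralP fI J1 J2 DI.
have JI t : Num.min t1 t2 <= t <= Num.max t1 t2 -> J t.
  have [_ iJ _] := sol; case: (leP t1 t2) => _ tI; [exact: iJ J1 J2 t tI|exact: iJ J2 J1 t tI].
have dI t : Num.min t1 t2 <= t <= Num.max t1 t2 -> is_derive t 1 (fun s => I (state r th s)) 0.
  move=> tI; have [dI dI0] := fI _ (DI t tI).
  by apply: (is_derive_cast (is_derive_diff_comp (is_derive_state (JI t tI)) dI)).
have [t _] := MVT_between dI; rewrite mul0r => /eqP.
by rewrite subr_eq0 => /eqP.
Qed.

Lemma state_phase_space t : J t -> phase_space (state r th t).
Proof. by move=> Jt; have [_ _ /(_ t Jt)[]] := sol. Qed.

Lemma conserved_along_solution t1 t2 : J t1 -> J t2 ->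
  angmom (state r th t1) = angmom (state r th t2) /\
  energy U ueq (state r th t1) = energy U ueq (state r th t2).
Proof.
move=> J1 J2; have JI t : Num.min t1 t2 <= t <= Num.max t1 t2 -> J t.
  have [_ iJ _] := sol; case: (leP t1 t2) => _ tI; [exact: iJ J1 J2 t tI|exact: iJ J2 J1 t tI].
split; [apply: (first_integral_along_solution first_integral_angmom) => // |
        apply: (first_integral_along_solution first_integral_energy) => //];
  by move=> t /JI/state_phase_space.
Qed.

End Solution.
End EquationsOfMotion.

(** * Trajectories *)

Lemma between_dist (R : realType) (s x u : R) :
  Num.min s x <= u <= Num.max s x -> `|u - s| <= `|x - s|.
Proof.
case: (ltgtP s x) => sx /andP[h1 h2].
- by rewrite !ger0_norm ?subr_ge0 ?lerB// ltW.
- by rewrite !ler0_norm ?subr_le0 ?lerN2 ?lerB// ltW.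
- by rewrite (_ : u = s) ?subrr ?normr0//; lra.
Qed.

(** The square y^2, multiplied by a suitable exponential, does not grow when moving away from t0, so
    it stays at its initial value 0. *)
Lemma gronwall_zero (R : realType) (y dy : R -> R) (c t0 t : R) :
  (forall s, Num.min t0 t <= s <= Num.max t0 t -> is_derive s 1 y (dy s)) ->
  (forall s, Num.min t0 t <= s <= Num.max t0 t -> `|2 * y s * dy s| <= c * y s ^+ 2) ->
  y t0 = 0 -> y t = 0.
Proof.
move=> dyE bnd y0.
(* The exponential must decay away from t0, hence its sign depends on the direction of time. *)
pose sg : R := if t0 <= t then -1 else 1.
pose g (s : R) : R := y s ^+ 2 * expR (sg * c * s).
pose dg (s : R) : R := (2 * y s * dy s + sg * c * y s ^+ 2) * expR (sg * c * s).
have dgE s : Num.min t0 t <= s <= Num.max t0 t -> is_derive s 1 g (dg s).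
  move=> /dyE dys.
  have dl : is_derive s 1 (fun s => sg * c * s) (sg * c).
    by eapply is_derive_cast; [repeat derive_step|rewrite /=; ring].
  have de := is_derive_fun_comp (is_derive_expR (sg * c * s)) dl.
  by eapply is_derive_cast; [rewrite /g; repeat derive_step|rewrite /dg /=; ring].
have [s sI gE] := MVT_between dgE.
have gt0 : g t0 = 0 by rewrite /g y0 expr0n /= mul0r.
have g_ge0 : 0 <= g t by rewrite mulr_ge0 ?sqr_ge0 ?expR_ge0.
have gt : g t <= 0.
  rewrite gt0 subr0 in gE; rewrite gE /dg.
  have e0 := expR_gt0 (sg * c * s); have := bnd s sI; rewrite ler_norml => /andP[b1 b2].
  rewrite /sg in e0 *; case: (leP t0 t) e0 => tt e0.
    rewrite mulr_le0_ge0 ?subr_ge0// mulr_le0_ge0 ?(ltW e0)//; lra.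
  rewrite mulr_ge0_le0 ?subr_le0 ?(ltW tt)// mulr_ge0 ?(ltW e0)//; lra.
have : g t = 0 by apply/eqP; rewrite eq_le gt.
by move=> /eqP; rewrite mulf_eq0 (gt_eqF (expR_gt0 _)) orbF sqrf_eq0 => /eqP.
Qed.

Section Trajectories.
Context {R : realType}.
Variables (U : R -> R) (ueq : R).
Hypothesis hU : smooth_potential U.
Variables (J : set R) (r th : R -> R).
Hypothesis sol : solution U J r th.

Local Notation Y := (radicand U ueq).
Local Notation V := (force U).

Lemma solution_interval t1 t2 t : J t1 -> J t2 ->
  Num.min t1 t2 <= t <= Num.max t1 t2 -> J t.
Proof.
have [_ iJ _] := sol => J1 J2.
by case: (leP t1 t2) => _ tI; [exact: iJ J1 J2 t tI|exact: iJ J2 J1 t tI].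
Qed.

Lemma solution_radius t : J t -> 0 < r t /\ is_derive t 1 r (derive1 r t).
Proof.
move=> Jt; have [_ _ /(_ t Jt)[r0 dr _ _ _]] := sol; split=> //.
by rewrite derive1E; exact: derivableP.
Qed.

Lemma solution_radicand t1 t2 : J t1 -> J t2 ->
  Y (angmom (state r th t1), energy U ueq (state r th t1), r t2) = derive1 r t2 ^+ 2.
Proof.
move=> J1 J2; have [-> ->] := conserved_along_solution ueq hU sol J1 J2.
exact: (radicand_energy U ueq (state r th t2)).
Qed.

Lemma continuous_radius t1 t2 : J t1 -> J t2 ->
  {within `[Num.min t1 t2, Num.max t1 t2], continuous r}.
Proof.
move=> J1 J2; apply: derivable_within_continuous => t; rewrite in_itv /= => tI.
by have [_ []] := solution_radius (solution_interval J1 J2 tI).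
Qed.

Lemma radius_between t1 t2 x : J t1 -> J t2 ->
  Num.min (r t1) (r t2) <= x <= Num.max (r t1) (r t2) ->
  exists2 t, J t & r t = x.
Proof.
wlog t12 : t1 t2 / t1 <= t2 => [hwlog J1 J2 xI|J1 J2 xI].
  case/orP: (le_total t1 t2) => h; first exact: hwlog xI.
  by apply: (hwlog t2 t1) => //; rewrite minC maxC.
have cr := continuous_radius J1 J2; rewrite (min_idPl t12) (max_idPr t12) in cr.
have [t tI rt] := IVT t12 cr xI; exists t => //.
apply: (solution_interval J1 J2); rewrite (min_idPl t12) (max_idPr t12).
by rewrite in_itv in tI.
Qed.

(** A double zero of Y forces quadratic smallness. With K the maximum of |V'| on [m, M], the mean
    value theorem gives |V| <= K |x - s|, and a second use with Y' = - 2 V gives the bound on Y. *)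
Lemma radicand_quadratic_bound (l e s m M : R) : 0 < m -> m <= s <= M ->
  Y (l, e, s) = 0 -> V (l, e, s) = 0 ->
  exists K, forall x, m <= x <= M -> `|Y (l, e, x)| <= 2 * K * (x - s) ^+ 2.
Proof.
move=> m0 sI Ys Vs.
pose V1 (x : R) : R := derive1n 2 U x + 3 * l ^+ 2 * x ^- 4.
have dV (x : R) : 0 < x -> is_derive x 1 (fun y => V (l, e, y)) (V1 x).
  exact: (is_derive_force hU).
have mM : m <= M by move/andP: sI => [/le_trans]; apply.
have cV1 : {within `[m, M], continuous (fun x => `|V1 x|)}.
  apply: continuous_in_subspaceT => x; rewrite inE /= in_itv /= => /andP[mx _].
  have x0 : 0 < x := lt_le_trans m0 mx.
  have x4 : x ^+ 4 != 0 by rewrite expf_neq0// gt_eqF.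
  have dU := is_derive_potential hU 2 x0.
  have [v [dV1 _]] : exists v, is_derive x 1 V1 v.
    by rewrite /V1; eexists; repeat derive_step.
  have cV1 : {for x, continuous V1}.
    exact/differentiable_continuous/derivable1_diffP.
  exact: (continuous_comp cV1 (@norm_continuous _ _ _)).
have [c _ cmax] := EVT_max mM cV1; exists `|V1 c| => x xI.
have btw u v : m <= u <= M -> m <= v <= M -> forall t, Num.min u v <= t <= Num.max u v -> m <= t <= M.
  by move=> uI vI t; case: (ltgtP u v); lra.
have pos t : m <= t <= M -> 0 < t by move=> /andP[+ _]; exact: lt_le_trans.
have Vb t : m <= t <= M -> `|V (l, e, t)| <= `|V1 c| * `|t - s|.
  move=> tI; have [u uI] := MVT_between (fun u h => dV u (pos _ (btw _ _ sI tI u h))).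
  rewrite Vs subr0 => ->; rewrite normrM ler_wpM2r//; apply: cmax.
  by rewrite in_itv /=; exact: btw uI.
have dY t (tI : m <= t <= M) := is_derive_radicand ueq hU l e (pos t tI).
have [u uI] := MVT_between (fun u h => dY u (btw _ _ sI xI u h)).
rewrite Ys subr0 => ->; rewrite -real_normK ?num_real// expr2 !normrM normrN.
rewrite (ger0_norm (x := 2))// mulrA ler_wpM2r// -!mulrA ler_wpM2l//.
have uI' := btw _ _ sI xI u uI.
apply: (le_trans (Vb u uI')); rewrite ler_wpM2l//.
exact: between_dist uI.
Qed.

(** For y = r - r(t0) the energy equation gives y'^2 = Y(r) <= 2 K y^2, hence |2 y y'| <= y^2 + y'^2
    <= (1 + 2 K) y^2, and Gronwall yields y = 0. This replaces an appeal to uniqueness of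
    solutions. *)
Lemma equilibrium_circular t0 : J t0 ->
  let p := state r th t0 in
  Y (angmom p, energy U ueq p, r t0) = 0 -> V (angmom p, energy U ueq p, r t0) = 0 ->
  forall t, J t -> r t = r t0.
Proof.
move=> J0 p Y0 V0 t Jt.
have mM : Num.min t0 t <= Num.max t0 t by rewrite ge_min !le_max !lexx.
have cr := continuous_radius J0 Jt.
(* The extreme radii on the time segment give a compact interval inside r > 0 on which the quadratic
   bound can be used. *)
have [a aI amin] := EVT_min mM cr; have [b bI bmax] := EVT_max mM cr.
rewrite in_itv /= in aI.
have [ra0 _] := solution_radius (solution_interval J0 Jt aI).
have rI s : Num.min t0 t <= s <= Num.max t0 t -> r a <= r s <= r b.
  by move=> sI; rewrite amin ?bmax// in_itv.
have t0I : Num.min t0 t <= t0 <= Num.max t0 t by rewrite ge_min le_max !lexx.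
have [K KP] := radicand_quadratic_bound ra0 (rI _ t0I) Y0 V0.
apply/eqP; rewrite -subr_eq0; apply/eqP.
apply: (@gronwall_zero R (fun s => r s - r t0) (derive1 r) (1 + 2 * K) t0 t) => [s sI|s sI|].
- have [_ dr] := solution_radius (solution_interval J0 Jt sI).
  by apply: (is_derive_cast (is_derive_funD dr (is_derive_fun_const (- r t0) s))); rewrite addr0.
- have := KP _ (rI _ sI); rewrite solution_radicand//; last exact: solution_interval sI.
  rewrite ger0_norm ?sqr_ge0// ler_norml.
  move: (r s - r t0) (derive1 r s) => y v h.
  have := sqr_ge0 (y - v); have := sqr_ge0 (y + v).
  by move=> h1 h2; apply/andP; split; nra.
- exact: subrr.
Qed.

End Trajectories.

(** * Signs of the radicand between r0 and the current radius *)

Section BranchDomain.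
Context {R : realType}.
Variables (U : R -> R) (ueq : R) (B : set (R * R)) (r0 : R * R -> R).
Hypotheses (hU : smooth_potential U) (hr0 : radius_branch U ueq B r0).

Local Notation Y := (radicand U ueq).
Local Notation V := (force U).
Local Notation LE p := (angmom p, energy U ueq p).

Lemma radicand_Ueff (l e x : R) : Y (l, e, x) = 2 * (e - Ueff U ueq l x).
Proof. by rewrite /radicand /time_radicand /Ueff /=; set i := (x ^+ 2)^-1; field. Qed.

Lemma derive1_Ueff (l e x : R) : 0 < x -> derive1 (Ueff U ueq l) x = V (l, e, x).
Proof.
move=> x0; have xn0 : x != 0 by rewrite gt_eqF.
have x2 : x ^+ 2 != 0 by rewrite expf_neq0.
have dU := is_derive_potential hU 0 x0.
have [_ <-] : is_derive x 1 (Ueff U ueq l) (V (l, e, x)).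
  rewrite /Ueff; eapply is_derive_cast; first by repeat derive_step.
  by rewrite /force /=; field.
by rewrite derive1E.
Qed.

Lemma branch_radius q : B q ->
  [/\ differentiable r0 q, 0 < r0 q & Y (q, r0 q) = 0 \/ V (q, r0 q) = 0].
Proof.
case: q => l e /(hr0.2)[dr [[rp tp]|[rp ip]]]; split=> //.
  by left; rewrite radicand_Ueff /= tp subrr mulr0.
by right; rewrite -derive1_Ueff.
Qed.

Lemma near_branch_radius q : B q -> \forall q' \near q,
  differentiable r0 q' /\ (Y (q', r0 q') = 0 \/ V (q', r0 q') = 0).
Proof.
move=> Bq; have nB : \forall q' \near q, B q' by apply: open_nbhs_nbhs; split=> //; exact: hr0.1.
by apply: filterS nB => q' /branch_radius[].
Qed.

(** By the intermediate value theorem the trajectory visits every radius between r0 and r, so Y =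
    v^2 >= 0 there. A zero strictly between would be an interior minimum of Y, hence also a zero of
    V, and the trajectory would be circular. *)
Lemma branch_domain_radicand p : branch_domain U ueq B r0 p ->
  [/\ 0 < rcoord p, 0 < Y (LE p, rcoord p),
      (forall x, Num.min (r0 (LE p)) (rcoord p) < x < Num.max (r0 (LE p)) (rcoord p) ->
        0 < Y (LE p, x))
    & 0 < Y (LE p, r0 (LE p)) \/ Y (LE p, r0 (LE p)) = 0 /\ V (LE p, r0 (LE p)) != 0].
Proof.
move=> [vp Bp [J [r [th [t [t' [sol Jt Jt' pE rt']]]]]]].
rewrite /base_radius in rt'.
have rtE : rcoord p = r t by rewrite -pE.
have vtE : vel p = derive1 r t by rewrite -pE.
have Yt s : J s -> Y (LE p, r s) = derive1 r s ^+ 2.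
  by move=> Js; rewrite -pE; exact: (solution_radicand ueq hU sol Jt Js).
(* Otherwise r would be constant on J; as J is open, the velocity at t would vanish, against v != 0
   at p. *)
have noncirc s : J s -> Y (LE p, r s) = 0 -> V (LE p, r s) != 0.
  move=> Js Ys; apply: contra_neq vp => Vs; rewrite vtE.
  have [Ls Es] := conserved_along_solution ueq hU sol Jt Js.
  have rc u : J u -> r u = r s.
    have ec := @equilibrium_circular _ _ ueq hU _ _ _ sol _ Js.
    by rewrite /= -Ls -Es pE in ec; exact: ec Ys Vs u.
  have n : \forall u \near t, cst (r s) u = r u.
    have nJ : \forall u \near t, J u.
      by apply: open_nbhs_nbhs; split=> //; case: sol.
    by apply: filterS nJ => u /rc.
  have [_ ] := near_eq_is_derive n (is_derive_fun_const (r s) t).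
  by rewrite derive1E.
have r_gt0 := (solution_radius sol Jt).1.
have visited x : Num.min (r0 (LE p)) (rcoord p) <= x <= Num.max (r0 (LE p)) (rcoord p) ->
    exists2 s, J s & r s = x.
  by rewrite -rt' rtE; exact: (radius_between sol Jt' Jt).
split.
- by rewrite rtE.
- by rewrite rtE Yt// -vtE lt_neqAle sqr_ge0 eq_sym sqrf_eq0 vp.
- move=> x xI; have xI' : Num.min (r0 (LE p)) (rcoord p) <= x <= Num.max (r0 (LE p)) (rcoord p).
    by move/andP: xI => [/ltW -> /ltW ->].
  have [s Js rs] := visited x xI'.
  have Yx_ge0 : 0 <= Y (LE p, x) by rewrite -rs Yt// sqr_ge0.
  rewrite lt_neqAle Yx_ge0 andbT eq_sym; apply/negP => /eqP Yx.
  have := noncirc s Js; rewrite rs => /(_ Yx) /eqP; apply.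
  have mMI : Num.min (r0 (LE p)) (rcoord p) <= Num.max (r0 (LE p)) (rcoord p).
    by rewrite ge_min !le_max !lexx.
  have x_gt0 u : Num.min (r0 (LE p)) (rcoord p) < u < Num.max (r0 (LE p)) (rcoord p) -> 0 < u.
    move=> /andP[+ _]; apply: lt_trans; rewrite lt_min rtE r_gt0 andbT.
    by have [] := branch_radius Bp.
  have dY u (uI : Num.min (r0 (LE p)) (rcoord p) < u < Num.max (r0 (LE p)) (rcoord p)) :=
    is_derive_radicand ueq hU (angmom p) (energy U ueq p) (x_gt0 u uI).
  (* At an interior minimum the derivative of Y is 0, and it equals - 2 V. *)
  have [_ E1] : is_derive x 1 (fun u => Y (LE p, u)) 0.
    apply: (derive1_at_min mMI) => [u||u uI].
      by rewrite in_itv /= => /dY[].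
    - by rewrite in_itv.
    - have [s' Js' <-] : exists2 s, J s & r s = u.
        by apply: visited; move: uI; rewrite in_itv /= => /andP[/ltW -> /ltW ->].
      by rewrite /= Yx Yt// sqr_ge0.
  have [_] := dY x xI; rewrite E1 => /esym/eqP.
  by rewrite mulf_eq0 oppr_eq0 pnatr_eq0 /= => /eqP.
- rewrite -rt'; have := noncirc t' Jt'; rewrite (Yt t' Jt').
  case: (eqVneq (derive1 r t') 0) => [->|v0] nc.
    by right; split; [rewrite expr0n|apply: nc; rewrite expr0n].
  by left; rewrite lt_neqAle sqr_ge0 eq_sym sqrf_eq0 v0.
Qed.

Lemma exists_primitives p : branch_domain U ueq B r0 p ->
  exists G0 G2, primitive_near U ueq (fun=> 1) r0 (LE p) (rcoord p) G0 /\
    primitive_near U ueq (fun x => x ^- 2) r0 (LE p) (rcoord p) G2.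
Proof.
move=> dp; have [rp Yp Yx Yr] := branch_domain_radicand dp.
have [_ Bp _] := dp; have [_ r0p _] := branch_radius Bp; have nr := near_branch_radius Bp.
have c0 c (x : R) : 0 < x -> is_derive x 1 (fun=> c : R) 0.
  by move=> _; exact: is_derive_fun_const.
have [G0 G0P] : exists G, primitive_near U ueq (fun=> 1) r0 (LE p) (rcoord p) G.
  by apply: (exists_primitive_near hU (c0 1) (c0 0) (c0 0)).
(* The functions a y^(-n) are closed under differentiation, so one rule supplies all three
   derivatives of the weight. *)
have dX n (a : R) (x : R) : 0 < x -> is_derive x 1 (fun y => a * y ^- n) (- (a * n%:R) * x ^- n.+1).
  move=> x0; have xn : x ^+ n != 0 by rewrite expf_neq0// gt_eqF.
  have xn0 : x != 0 by rewrite gt_eqF.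
  eapply is_derive_cast; first by repeat derive_step.
  case: n xn => [|n] xn /=; first by rewrite !mulr0n; ring.
  by rewrite !exprS; field; rewrite xn0 expf_neq0.
have [G2 G2P] : exists G, primitive_near U ueq (fun x => x ^- 2) r0 (LE p) (rcoord p) G.
  (* The factor 1 puts the weight into the form a y^(-n). *)
  have -> : (fun x : R => x ^- 2) = (fun x : R => 1 * x ^- 2).
    by apply/funext => x; rewrite mul1r.
  apply: (exists_primitive_near hU (@dX _ _) (@dX _ _) (@dX _ _)) => //.
  by move=> x x0; rewrite mul1r invr_gt0 exprn_gt0.
by exists G0, G2.
Qed.

End BranchDomain.

(** * First integrals *)

Lemma near_eq_diff (R : realType) (V W : normedModType R) (f g : V -> W) (x : V) :
  (\forall y \near x, f y = g y) -> differentiable f x ->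
  differentiable g x /\ 'd g x = 'd f x :> (V -> W).
Proof.
move=> fg df; have [cdf fE] := (diff_locallyP x f).1 df.
have gE : g \o shift x = cst (g x) + 'd f x +o_ 0 id.
  apply/eqaddoP => e e0; have {}fE := (eqaddoP _ _ _ _).1 fE e e0.
  have fg0 := fg; rewrite (near_shift 0 x) in fg0.
  apply: filterS2 fE fg0 => h; rewrite /= subr0 => H fgh.
  have fgx := nbhs_singleton fg.
  have -> : (g \o shift x - (cst (g x) + 'd f x)) h = (f \o shift x - (cst (f x) + 'd f x)) h.
    by rewrite !fctE /= fgh fgx.
  exact: H.
have dE := diff_unique cdf gE; split; last exact: dE.
apply/diff_locallyP; rewrite dE; split; [exact: cdf|exact: gE].
Qed.

(** * Theta and T as differentiable expressions near a state *)

Section LocalFormulas.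
Context {R : realType}.
Variables (U : R -> R) (ueq : R) (B : set (R * R)) (r0 : R * R -> R).
Hypotheses (hU : smooth_potential U) (hr0 : radius_branch U ueq B r0).

Local Notation Y := (radicand U ueq).
Local Notation V := (force U).
Local Notation LE p := (angmom p, energy U ueq p).

Lemma angle_radicandE (l e x : R) : 0 < x ->
  angle_radicand U ueq l e x = x ^+ 4 * Y (l, e, x).
Proof.
move=> x0; have xn0 : x != 0 by rewrite gt_eqF.
by rewrite /angle_radicand /radicand /time_radicand /=; field.
Qed.

Lemma sqrt_angle_radicand (l e x : R) : 0 < x ->
  Num.sqrt (angle_radicand U ueq l e x) = x ^+ 2 * Num.sqrt (Y (l, e, x)).
Proof.
move=> x0; rewrite angle_radicandE// sqrtrM ?exprn_ge0 ?ltW//.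
by rewrite -[x ^+ 4]/(x ^+ (2 * 2)) exprM sqrtr_sqr ger0_norm ?exprn_ge0 ?ltW.
Qed.

Lemma time_integrand_is p (v : R) :
  oriented_integral_is (r0 (LE p)) (rcoord p) (fun x => 1 / Num.sqrt (Y (LE p, x))) v ->
  oriented_integral_is (base_radius U ueq r0 p) (rcoord p) (time_integrand U ueq p)
    (Num.sg (vel p) * v).
Proof.
move=> /(oint_scale (Num.sg (vel p))); apply: eq_oint => x _.
by rewrite /time_integrand mulrA mulr1.
Qed.

Lemma angle_integrand_is p (v : R) : 0 < r0 (LE p) -> 0 < rcoord p ->
  oriented_integral_is (r0 (LE p)) (rcoord p) (fun x => x ^- 2 / Num.sqrt (Y (LE p, x))) v ->
  oriented_integral_is (base_radius U ueq r0 p) (rcoord p) (angle_integrand U ueq p)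
    (Num.sg (vel p) * v).
Proof.
move=> r0p rp /(oint_scale (Num.sg (vel p))); apply: eq_oint => x /andP[xm _].
have x0 : 0 < x by apply: lt_le_trans xm; rewrite lt_min r0p.
by rewrite /angle_integrand sqrt_angle_radicand// [in RHS]invfM.
Qed.

Definition regular_primitives (G0 G2 : R * R * R -> R) (z : R * R * R) :=
  [/\ 0 < z.2 /\ 0 < Y z, differentiable G0 z, differentiable G2 z,
    is_derive z.2 1 (fun x => G0 (z.1, x)) (Num.sqrt (Y z))^-1
  & is_derive z.2 1 (fun x => G2 (z.1, x)) (z.2 ^- 2 / Num.sqrt (Y z))].

Definition coords (q : phase R) : R * R * R := (LE q, rcoord q).

Lemma differentiable_coords q : 0 < rcoord q -> differentiable coords q.
Proof.
move=> q0; have dL := differentiable_angmom q; have dE := differentiable_energy ueq hU q0.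
have dr : differentiable (@rcoord R) q by rewrite /rcoord; repeat differentiable_step.
by apply: differentiable_pair => //; exact: differentiable_pair.
Qed.

(** Near p the velocity does not vanish, so its sign can be frozen at its value at p. The last two
    formulas hold at every q near p, whether or not the trajectory of q is known to pass through r0,
    and so determine the differentials at p. *)
Lemma local_formulas p : branch_domain U ueq B r0 p -> exists G0 G2,
  [/\ oriented_integral_is (r0 (LE p)) (rcoord p) (fun x => 1 / Num.sqrt (Y (LE p, x)))
        (G0 (coords p)),
      oriented_integral_is (r0 (LE p)) (rcoord p) (fun x => x ^- 2 / Num.sqrt (Y (LE p, x)))
        (G2 (coords p)),
      \forall z \near coords p, regular_primitives G0 G2 z
    & \forall q \near p, [/\ Num.sg (vel q) = Num.sg (vel p),
        0 < rcoord q,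
        Tint U ueq r0 q = time q - Num.sg (vel p) * G0 (coords q)
      & Theta U ueq r0 q = angle q - angmom q * (Num.sg (vel p) * G2 (coords q))]].
Proof.
move=> dp; have [rp _ _ _] := branch_domain_radicand hU hr0 dp.
have [vp Bp _] := dp; have [G0 [G2 [G0P G2P]]] := exists_primitives hU hr0 dp.
exists G0, G2; split.
- by have [_ _ _ _] := nbhs_singleton G0P.
- by have [_ _ _ _] := nbhs_singleton G2P.
- apply: filterS2 G0P G2P => z [dG0 z0 Yz dxG0 _] [dG2 _ _ dxG2 _]; split=> //.
  by rewrite -[X in is_derive _ _ _ X]mul1r.
- have cc : {for p, continuous coords}.
    exact/differentiable_continuous/differentiable_coords.
  have n0 : \forall q \near p, B (LE q).
    have cLE : {for p, continuous (fun q => LE q)}.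
      exact: (continuous_comp cc (@continuous_at_fst _ _ _)).
    by apply: cLE; apply: open_nbhs_nbhs; split=> //; exact: hr0.1.
  have n1 := cc _ G0P; have n2 := cc _ G2P.
  have n3 : \forall q \near p, Num.sg (vel q) = Num.sg (vel p).
    have cv : {for p, continuous (@vel R)}.
      by apply: differentiable_continuous; rewrite /vel; repeat differentiable_step.
    have [v0|v0] : vel p < 0 \/ 0 < vel p by apply/orP; rewrite -neq_lt.
      have n : \forall q \near p, vel q < 0 by have /cvgr_lt := cv; apply.
      by apply: filterS n => q vq; rewrite !ltr0_sg.
    have n : \forall q \near p, 0 < vel q by have /cvgr_gt := cv; apply.
    by apply: filterS n => q vq; rewrite !gtr0_sg.
  apply: filterS3 n0 (filterI n1 n2) n3 => q Bq [/= [_ rq _ _ oi0] [_ _ _ _ oi2]] sq.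
  have [_ r0q _] := branch_radius hU hr0 Bq; split=> //.
  + by rewrite /Tint (time_integrand_is oi0).2 sq.
  + by rewrite /Theta (angle_integrand_is r0q rq oi2).2 sq.
Qed.

End LocalFormulas.

Lemma diff_slice (R : realType) (V : normedModType R) (G : V * R -> R) (z : V * R) (d v : R) :
  differentiable G z -> is_derive z.2 1 (fun x => G (z.1, x)) d ->
  'd G z (0, v) = d * v.
Proof.
case: z => p s /= dG dx.
have ds : is_derive s 1 (fun x : R => (p, x)) ((0, 1) : V * R).
  by apply: is_derive_pair; exact: is_derive_cst.
have [_ E1] := is_derive_diff_comp ds dG; have [_ E2] := dx.
have -> : ((0, v) : V * R) = v *: ((0, 1) : V * R).
  transitivity ((v *: 0, v * 1) : V * R); last by [].
  by rewrite scaler0 mulr1.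
by rewrite linearZ /= mulrC /GRing.scale /=; congr (_ * _); exact: etrans (esym E1) E2.
Qed.

Lemma is_derive_unique (R : realType) (f : R -> R) (x a b : R) :
  is_derive x 1 f a -> is_derive x 1 f b -> a = b.
Proof. by move=> [_ <-] [_ <-]. Qed.

Lemma is_derive_diff_comp_at (R : realType) (V W : normedModType R) (G : V -> W)
    (g : R -> V) (t : R) (p v : V) : g t = p ->
  is_derive t 1 g v -> differentiable G p -> is_derive t 1 (fun s => G (g s)) ('d G p v).
Proof. by move=> <-; exact: is_derive_diff_comp. Qed.

Lemma exists_curve (R : realType) (p x : phase R) :
  exists g : R -> phase R, g 0 = p /\ is_derive (0 : R) 1 g x.
Proof.
have line (a b : R) : is_derive (0 : R) 1 (fun h : R => a + h * b) b.
  by eapply is_derive_cast; [repeat derive_step|rewrite /=; ring].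
case: p x => -[[[p1 p2] p3] p4] p5 [[[[x1 x2] x3] x4] x5].
exists (fun h => (p1 + h * x1, p2 + h * x2, p3 + h * x3, p4 + h * x4, p5 + h * x5)).
by split; [rewrite !mul0r !addr0|do 4 apply: is_derive_pair => //].
Qed.

Lemma sum_ord3 (V : nmodType) (F : 'I_3 -> V) : \sum_(i < 3) F i = F 0 + F 1 + F 2.
Proof.
rewrite !big_ord_recl big_ord0 addr0 addrA.
by congr (F _ + F _ + F _); exact/val_inj.
Qed.

Section FirstIntegrals.
Context {R : realType}.
Variables (U : R -> R) (ueq : R) (B : set (R * R)) (r0 : R * R -> R).
Hypotheses (hU : smooth_potential U) (hr0 : radius_branch U ueq B r0).

Local Notation Y := (radicand U ueq).
Local Notation Th := (Theta U ueq r0).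
Local Notation T := (Tint U ueq r0).
Local Notation LE p := (angmom p, energy U ueq p).

Lemma diff_coords p x : 0 < rcoord p ->
  'd (coords U ueq) p x = ('d (@angmom R) p x, 'd (energy U ueq) p x, x.1.1.1.2).
Proof.
move=> p0; have dL := differentiable_angmom p; have dE := differentiable_energy ueq hU p0.
have dr : differentiable (@rcoord R) p by rewrite /rcoord; repeat differentiable_step.
have dLE := differentiable_pair dL dE.
rewrite /coords diff_pair//= diff_pair//=; congr (_, _).
apply: diff_along_line => //; rewrite /rcoord /=.
by eapply is_derive_cast; [repeat derive_step|rewrite /=; ring].
Qed.

Lemma diff_time (p x : phase R) : 'd (@time R) p x = x.1.1.1.1.
Proof.
apply: diff_along_line; first by rewrite /time; repeat differentiable_step.
by rewrite /time /=; eapply is_derive_cast; [repeat derive_step|rewrite /=; ring].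
Qed.

Lemma diff_angle (p x : phase R) : 'd (@angle R) p x = x.1.1.2.
Proof.
apply: diff_along_line; first by rewrite /angle; repeat differentiable_step.
by rewrite /angle /=; eapply is_derive_cast; [repeat derive_step|rewrite /=; ring].
Qed.

Lemma sqrt_radicand_coords p : Num.sqrt (Y (coords U ueq p)) = `|vel p|.
Proof. by rewrite radicand_energy sqrtr_sqr. Qed.

(** On a vector x with dL = dE = 0, the point (L, E, r) moves only in r to first order, so only the
    radial derivative of the primitive contributes, which is 1 / |v| because Y = v^2 at the current
    radius. *)
Lemma diff_Tint p : branch_domain U ueq B r0 p -> differentiable T p /\
  forall x, 'd (@angmom R) p x = 0 -> 'd (energy U ueq) p x = 0 ->
    'd T p x = x.1.1.1.1 - Num.sg (vel p) * (`|vel p|^-1 * x.1.1.1.2).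
Proof.
move=> dp; have [G0 [G2 [_ _ nG nq]]] := local_formulas hU hr0 dp.
have [_ rp _ _] := nbhs_singleton nq.
have [_ dG0 _ dxG0 _] := nbhs_singleton nG.
have dc := differentiable_coords ueq hU rp.
have dGc := differentiable_comp dc dG0.
have dt : differentiable (@time R) p by rewrite /time; repeat differentiable_step.
pose f q : R := time q - Num.sg (vel p) * G0 (coords U ueq q).
have df : differentiable f p by rewrite /f; repeat (first [assumption | differentiable_step]).
have nf : \forall q \near p, f q = T q by apply: filterS nq => q [_ _ -> _].
have [dT dE] := near_eq_diff nf df; split; first exact: dT.
move=> x Lx Ex; rewrite dE; have [g [g0 dg]] := exists_curve p x.
have dcg := is_derive_diff_comp_at g0 dg dc.
have dGg := is_derive_diff_comp_at (g := fun h => coords U ueq (g h)) (congr1 _ g0) dcg dG0.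
have dtg := is_derive_diff_comp_at g0 dg dt.
rewrite (diff_coords x rp) Lx Ex (diff_slice _ dG0 dxG0) sqrt_radicand_coords in dGg.
rewrite diff_time in dtg.
have dsg := is_derive_funM (is_derive_fun_const (Num.sg (vel p)) 0) dGg.
have dfg := is_derive_funD dtg (is_derive_funN dsg).
by rewrite (is_derive_unique (is_derive_diff_comp_at g0 dg df) dfg) mulr0 addr0.
Qed.

Lemma diff_Theta p : branch_domain U ueq B r0 p -> differentiable Th p /\
  forall x, 'd (@angmom R) p x = 0 -> 'd (energy U ueq) p x = 0 ->
    'd Th p x = x.1.1.2 -
      angmom p * (Num.sg (vel p) * (rcoord p ^- 2 / `|vel p| * x.1.1.1.2)).
Proof.
move=> dp; have [G0 [G2 [_ _ nG nq]]] := local_formulas hU hr0 dp.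
have [_ rp _ _] := nbhs_singleton nq.
have [_ _ dG2 _ dxG2] := nbhs_singleton nG.
have dc := differentiable_coords ueq hU rp.
have dGc := differentiable_comp dc dG2; have dL := differentiable_angmom p.
have dt : differentiable (@angle R) p by rewrite /angle; repeat differentiable_step.
pose f q : R := angle q - angmom q * (Num.sg (vel p) * G2 (coords U ueq q)).
have df : differentiable f p by rewrite /f; repeat (first [assumption | differentiable_step]).
have nf : \forall q \near p, f q = Th q by apply: filterS nq => q [_ _ _ ->].
have [dT dE] := near_eq_diff nf df; split; first exact: dT.
move=> x Lx Ex; rewrite dE; have [g [g0 dg]] := exists_curve p x.
have dcg := is_derive_diff_comp_at g0 dg dc.
have dGg := is_derive_diff_comp_at (g := fun h => coords U ueq (g h)) (congr1 _ g0) dcg dG2.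
have dLg := is_derive_diff_comp_at g0 dg dL.
have dtg := is_derive_diff_comp_at g0 dg dt.
rewrite (diff_coords x rp) Lx Ex (diff_slice _ dG2 dxG2) sqrt_radicand_coords in dGg.
rewrite diff_angle in dtg; rewrite Lx in dLg.
have dsg := is_derive_funM (is_derive_fun_const (Num.sg (vel p)) 0) dGg.
have dfg := is_derive_funD dtg (is_derive_funN (is_derive_funM dLg dsg)).
by rewrite (is_derive_unique (is_derive_diff_comp_at g0 dg df) dfg) !mulr0 !addr0 g0.
Qed.

(** Along the flow the radius changes at rate v, while the radial derivative of the time integral is
    sg(v) / |v|. The product 1 cancels dt/dt, and for Theta it leaves L r^(-2), which cancels the
    angular velocity. *)
Lemma sg_inv_norm_mul (v : R) : v != 0 -> Num.sg v * (`|v|^-1 * v) = 1.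
Proof. by move=> v0; rewrite mulrCA -normrEsg mulVf// normr_eq0. Qed.

Lemma first_integral_Tint : first_integral_on U (branch_domain U ueq B r0) T.
Proof.
apply/first_integralP => p dp; have [dT dE] := diff_Tint dp; split=> //.
have [rp _ _ _] := branch_domain_radicand hU hr0 dp; have [vp _ _] := dp.
have [_ L0] := (first_integralP _ _ _).1 (first_integral_angmom U) p rp.
have [_ E0] := (first_integralP _ _ _).1 (first_integral_energy ueq hU) p rp.
by rewrite dE// /vector_field /= sg_inv_norm_mul ?subrr.
Qed.

Lemma first_integral_Theta : first_integral_on U (branch_domain U ueq B r0) Th.
Proof.
apply/first_integralP => p dp; have [dT dE] := diff_Theta dp; split=> //.
have [rp _ _ _] := branch_domain_radicand hU hr0 dp; have [vp _ _] := dp.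
have [_ L0] := (first_integralP _ _ _).1 (first_integral_angmom U) p rp.
have [_ E0] := (first_integralP _ _ _).1 (first_integral_energy ueq hU) p rp.
rewrite dE// /vector_field /= -[X in _ * (_ * X)]mulrA.
rewrite [X in _ * X]mulrCA sg_inv_norm_mul// mulr1 /angmom mulfK ?subrr//.
by rewrite expf_neq0// gt_eqF.
Qed.

(** The three differentials are triangular on unit vectors. The theta direction is killed by dL and
    dE and has dTheta = 1; the v direction has dL = 0 and dE = v; the omega direction has dL = r^2.
    The coefficients vanish in this order. *)
Lemma functionally_independent_LETh p : branch_domain U ueq B r0 p ->
  functionally_independent_at (tnth [tuple @angmom R; energy U ueq; Th]) p.
Proof.
move=> dp; have [dT dE] := diff_Theta dp; have [vp _ _] := dp.
have [rp _ _ _] := branch_domain_radicand hU hr0 dp.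
split.
  case=> -[|[|[|//]]] i3; rewrite /tnth /=.
  - exact: differentiable_angmom.
  - exact: differentiable_energy.
  - exact: dT.
move=> c; have sumE h : \sum_(i < 3) c i * 'd (tnth [tuple @angmom R; energy U ueq; Th] i) p h =
    c 0 * 'd (@angmom R) p h + c 1 * 'd (energy U ueq) p h + c 2 * 'd Th p h.
  exact: sum_ord3.
move=> c0.
have {sumE} c0 h : c 0 * (h.2 * rcoord p ^+ 2 + 2 * angvel p * rcoord p * h.1.1.1.2)
    + c 1 * (vel p * h.1.2 + angvel p * rcoord p ^+ 2 * h.2
      + (angvel p ^+ 2 * rcoord p + derive1 U (rcoord p)) * h.1.1.1.2)
    + c 2 * 'd Th p h = 0.
  by rewrite -diff_angmom -(diff_energy ueq hU h rp) -sumE; exact: c0.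
have c3 : c 2 = 0.
  pose h : phase R := (0, 0, 1, 0, 0).
  have Lh : 'd (@angmom R) p h = 0 by rewrite diff_angmom /= !(mulr0, mul0r, addr0).
  have Eh : 'd (energy U ueq) p h = 0.
    by rewrite (diff_energy ueq hU h rp) /= !(mulr0, mul0r, addr0).
  have := c0 h; rewrite (dE h Lh Eh).
  by rewrite /= !(mulr0, mul0r, addr0, add0r, subr0, mulr1).
have c2 : c 1 = 0.
  have := c0 (0, 0, 0, 1, 0); rewrite c3.
  rewrite /= !(mulr0, mul0r, addr0, add0r, mulr1) => /eqP.
  by rewrite mulf_eq0 (negbTE vp) orbF => /eqP.
have c1 : c 0 = 0.
  have := c0 (0, 0, 0, 0, 1); rewrite c3 c2.
  rewrite /= !(mulr0, mul0r, addr0, add0r, mul1r) => /eqP.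
  by rewrite mulf_eq0 sqrf_eq0 (gt_eqF rp) orbF => /eqP.
case=> -[|[|[|//]]] i3; [rewrite -[RHS]c1|rewrite -[RHS]c2|rewrite -[RHS]c3];
  by congr (c _); exact/val_inj.
Qed.

End FirstIntegrals.

(** * Completeness *)

Section Completeness.
Context {R : realType}.
Variables (U : R -> R) (ueq : R) (B : set (R * R)) (r0 : R * R -> R).
Hypotheses (hU : smooth_potential U) (hr0 : radius_branch U ueq B r0).

Local Notation Y := (radicand U ueq).
Local Notation V := (force U).
Local Notation Th := (Theta U ueq r0).
Local Notation T := (Tint U ueq r0).

Definition invariants (q : phase R) : R * R * R * R :=
  (angmom q, energy U ueq q, Th q, T q).

(* The state of radius s on the trajectory with invariants y = (L, E, Theta, T)
   and sgn v = sg. *)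
Definition state_of (sg : R) (G0 G2 : R * R * R -> R) (w : R * R * R * R * R) : phase R :=
  (w.1.2 + sg * G0 (w.1.1.1, w.2), w.2, w.1.1.2 + w.1.1.1.1 * (sg * G2 (w.1.1.1, w.2)),
   sg * Num.sqrt (Y (w.1.1.1, w.2)), w.1.1.1.1 * w.2 ^- 2).

Lemma differentiable_state_of sg G0 G2 w :
  regular_primitives U ueq G0 G2 (w.1.1.1, w.2) ->
  differentiable (state_of sg G0 G2) w.
Proof.
move=> [[/= w0 Yw] dG0 dG2 _ _]; have w2 : w.2 ^+ 2 != 0 by rewrite sqrf_eq0 gt_eqF.
have dz : differentiable (fun v : R * R * R * R * R => (v.1.1.1, v.2)) w.
  by repeat differentiable_step.
have dG0z := @differentiable_comp _ _ _ _ _ G0 _ dz dG0.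
have dG2z := @differentiable_comp _ _ _ _ _ G2 _ dz dG2.
have dY := differentiable_radicand ueq hU (z := (w.1.1.1, w.2)) w0.
have dYz := @differentiable_comp _ _ _ _ _ Y _ dz dY.
have dS : differentiable (fun v : R * R * R * R * R => Num.sqrt (Y (v.1.1.1, v.2))) w.
  by apply: differentiable_fun_comp => //; have [] := is_derive1_sqrt Yw.
by rewrite /state_of; repeat (first [assumption | differentiable_step]).
Qed.

(** With the invariants fixed, varying the radius runs along the flow reparametrised by r. The
    factor is dt/dr = 1 / v, which for v = sg sqrt(Y) and sg^2 = 1 reads sg / sqrt(Y). *)
Lemma is_derive_state_of sg G0 G2 (y : R * R * R * R) (s : R) : sg ^+ 2 = 1 ->
  regular_primitives U ueq G0 G2 (y.1.1, s) ->
  is_derive s 1 (fun x => state_of sg G0 G2 (y, x))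
    ((sg / Num.sqrt (Y (y.1.1, s))) *: vector_field U (state_of sg G0 G2 (y, s))).
Proof.
move=> sg2 [[/= s0 Ys] _ _ dxG0 dxG2]; case: y Ys dxG0 dxG2 => -[[l e] h] tau /= Ys dxG0 dxG2.
have sn0 : s != 0 by rewrite gt_eqF.
have s2 : s ^+ 2 != 0 by rewrite expf_neq0.
have S0 : Num.sqrt (Y (l, e, s)) != 0 by rewrite gt_eqF// sqrtr_gt0.
have dY := is_derive_radicand ueq hU l e s0.
have dS := is_derive_fun_sqrt (f := fun x => Y (l, e, x)) Ys dY.
rewrite /state_of /vector_field /vel /angvel /rcoord /=.
set S := Num.sqrt (Y (l, e, s)) in S0 dxG0 dxG2 dS *.
pose k := sg / S.
change (is_derive s 1 (fun x : R => (tau + sg * G0 (l, e, x), x, h + l * (sg * G2 (l, e, x)),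
   sg * Num.sqrt (Y (l, e, x)), l * x ^- 2))
   ((k * 1, k * (sg * S), k * (l * s ^- 2),
     k * ((l * s ^- 2) ^+ 2 * s - derive1 U s), k * - (2 * (l * s ^- 2) * (sg * S) / s)) : phase R)).
have kS : k * (sg * S) = 1 by rewrite /k mulrACA -expr2 sg2 mulVf// mulr1.
apply: is_derive_pair; last first.
  eapply is_derive_cast; first by repeat derive_step.
  have -> : k * - (2 * (l * s ^- 2) * (sg * S) / s) = - (2 * (l * s ^- 2)) / s * (k * (sg * S)).
    by ring.
  by rewrite kS /=; field.
apply: is_derive_pair; last first.
  eapply is_derive_cast; first by repeat derive_step.
  by rewrite /= -/S /k /force /=; field; rewrite sn0 S0.
apply: is_derive_pair; last first.
  eapply is_derive_cast; first by repeat derive_step.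
  by rewrite /= /k; field; rewrite ?sn0 ?S0.
apply: is_derive_pair; last first.
  by rewrite kS; exact: is_derive_fun_id.
eapply is_derive_cast; first by repeat derive_step.
by rewrite /= /k; field.
Qed.

Lemma continuous_invariants p : branch_domain U ueq B r0 p ->
  {for p, continuous (fun q => (invariants q, rcoord q))}.
Proof.
move=> dp; have [rp _ _ _] := branch_domain_radicand hU hr0 dp.
have dL := differentiable_angmom p; have dE := differentiable_energy ueq hU rp.
have [dTh _] := diff_Theta hU hr0 dp; have [dT _] := diff_Tint hU hr0 dp.
have dr : differentiable (@rcoord R) p by rewrite /rcoord; repeat differentiable_step.
apply: differentiable_continuous; apply: differentiable_pair => //.
apply: differentiable_pair => //; apply: differentiable_pair => //.
exact: differentiable_pair.
Qed.

(* Along state_of the first integral has derivative ('d I (vector_field)) / v = 0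
   in the radius, so I may be evaluated at the fixed radius of p. *)
Lemma first_integral_straightened (D : set (phase R)) (I : phase R -> R) p :
  open D -> first_integral_on U D I -> D p -> branch_domain U ueq B r0 p ->
  exists G0 G2, let G := state_of (Num.sg (vel p)) G0 G2 in
    (\forall y \near invariants p, D (G (y, rcoord p)) /\
       differentiable (fun y' => G (y', rcoord p)) y) /\
    (\forall q \near p, I q = I (G (invariants q, rcoord p))).
Proof.
move=> oD fI Dp dp; have [G0 [G2 [_ _ nG nq]]] := local_formulas hU hr0 dp.
exists G0, G2 => G; have [vp _ _] := dp.
have sg2 : Num.sg (vel p) ^+ 2 = 1 by rewrite sqr_sg vp.
(* Solving the formulas for T and Theta for t and theta, and recovering v from its sign and v^2 = Y,
   shows that [G] inverts the map from q to its invariants and radius. *)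
have GK : \forall q \near p, G (invariants q, rcoord q) = q.
  apply: filterS nq => q [sq rq TE ThE]; rewrite /G /state_of /= TE ThE.
  have -> : Num.sg (vel p) * Num.sqrt (Y (angmom q, energy U ueq q, rcoord q)) = vel q.
    by rewrite radicand_energy sqrtr_sqr -sq -numEsg.
  rewrite /coords !subrK /angmom mulfK ?expf_neq0 ?gt_eqF//.
  by case: q {sq rq TE ThE} => -[[[? ?] ?] ?] ?.
pose w0 := (invariants p, rcoord p).
have Gw0 : G w0 = p by exact: nbhs_singleton GK.
have cz : {for w0, continuous (fun w : R * R * R * R * R => (w.1.1.1, w.2))}.
  by apply: differentiable_continuous; repeat differentiable_step.
have nreg : \forall w \near w0, regular_primitives U ueq G0 G2 (w.1.1.1, w.2) := cz _ nG.
have dG w : regular_primitives U ueq G0 G2 (w.1.1.1, w.2) -> differentiable G w.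
  exact: differentiable_state_of.
have nD : \forall w \near w0, D (G w).
  have cG := differentiable_continuous (dG _ (nbhs_singleton nreg)).
  by apply: cG; rewrite Gw0; exact: open_nbhs_nbhs.
(* A product ball contains, with the invariants of q, every radius between those of p and q, so the
   radius can be moved without leaving [D]. *)
have [d /= d0 dP] := (nbhs_ballP _ _).1 (filterI nD nreg).
split.
  apply/nbhs_ballP; exists d => //= y yd.
  have [Dy regy] := dP (y, rcoord p) (conj yd (ballxx _ d0)); split=> //.
  have dy : differentiable (fun y' : R * R * R * R => (y', rcoord p)) y.
    by repeat differentiable_step.
  exact: (@differentiable_comp _ _ _ _ _ G _ dy (dG _ regy)).
have nb : \forall q \near p, ball w0 d (invariants q, rcoord q).
  by apply: (continuous_invariants dp); exact: nbhsx_ballx.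
apply: filterS2 GK nb => q qE [/= bi br].
have dIs s : Num.min (rcoord p) (rcoord q) <= s <= Num.max (rcoord p) (rcoord q) ->
    is_derive s 1 (fun x => I (G (invariants q, x))) 0.
  move=> sI; have [Ds regs] := dP (invariants q, s) (conj bi (ball_between sI br)).
  have [dI dI0] := (first_integralP _ _ _).1 fI _ Ds.
  apply: (is_derive_cast (is_derive_diff_comp (is_derive_state_of sg2 regs) dI)).
  by rewrite linearZ /= dI0 scaler0.
have [s _] := MVT_between dIs; rewrite mul0r qE => /eqP.
by rewrite subr_eq0 => /eqP.
Qed.

Lemma first_integral_function (D : set (phase R)) (I : phase R -> R) p :
  open D -> first_integral_on U D I -> D p -> branch_domain U ueq B r0 p ->
  locally_function_of invariants I p.
Proof.
move=> oD fI Dp dp; have [G0 [G2 [nG nI]]] := first_integral_straightened oD fI Dp dp.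
exists (fun y => I (state_of (Num.sg (vel p)) G0 G2 (y, rcoord p))).
have ci : {for p, continuous invariants}.
  exact: (continuous_comp (continuous_invariants dp) (@continuous_at_fst _ _ _)).
pose P y := D (state_of (Num.sg (vel p)) G0 G2 (y, rcoord p)) /\
  differentiable (fun y' => state_of (Num.sg (vel p)) G0 G2 (y', rcoord p)) y.
have n1 : \forall q \near p, P (invariants q) := ci P nG.
apply: filterS2 n1 nI => q [DG dG] Iq; split=> //.
exact: (@differentiable_comp _ _ _ _ _ I _ dG (fI _ DG).1).
Qed.

(** In [state_of] the value of T is only added to the time component. A constant of motion ignores
    that component, so T can be frozen at its value at p. *)
Lemma constant_of_motion_function (D : set (phase R)) (I : phase R -> R) p :
  open D -> constant_of_motion_on U D I -> D p -> branch_domain U ueq B r0 p ->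
  locally_function_of (fun q => (invariants q).1) I p.
Proof.
move=> oD [fI tI] Dp dp; have [G0 [G2 [nG nI]]] := first_integral_straightened oD fI Dp dp.
pose G := state_of (Num.sg (vel p)) G0 G2.
(* The two states agree except for their times. *)
have IG y t t' s : D (G (y, t, s)) -> D (G (y, t', s)) -> I (G (y, t, s)) = I (G (y, t', s)).
  exact: tI.
exists (fun y => I (G (y, T p, rcoord p))).
have ci : {for p, continuous invariants}.
  exact: (continuous_comp (continuous_invariants dp) (@continuous_at_fst _ _ _)).
pose P y := D (G (y, rcoord p)) /\ differentiable (fun y' => G (y', rcoord p)) y.
have n1 : \forall q \near p, P (invariants q) := ci P nG.
have ci3 : {for p, continuous (fun q => ((invariants q).1, T p))}.
  apply: continuous_at_pair; last exact: cvg_cst.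
  exact: (continuous_comp ci (@continuous_at_fst _ _ _)).
have n2 : \forall q \near p, P ((invariants q).1, T p) := ci3 P nG.
have {}nI : \forall q \near p, I q = I (G (invariants q, rcoord p)) := nI.
apply: filterS3 n1 n2 nI => q.
rewrite [in P (invariants q)](surjective_pairing (invariants q)).
rewrite [in G (invariants q, rcoord p)](surjective_pairing (invariants q)).
move: (invariants q).1 (invariants q).2 => y t [DG _] [D3 d3] Iq.
split; last by rewrite Iq; exact: IG DG D3.
have dy : differentiable (fun y' : R * R * R => (y', T p)) y by repeat differentiable_step.
have d3y := @differentiable_comp _ _ _ _ _ (fun y' => G (y', rcoord p)) _ dy d3.
exact: (@differentiable_comp _ _ _ _ _ I _ d3y (fI _ D3).1).
Qed.

End Completeness.

Theorem theorem2 (R : realType) (U : R -> R) (req : \bar R) (ueq : R)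
    (B : set (R * R)) (r0 : R * R -> R)
    (hU : smooth_potential U) (heq : equilibrium U req ueq)
    (hr0 : radius_branch U ueq B r0) :
  let L := @angmom R in
  let E := energy U ueq in
  let Th := Theta U ueq r0 in
  let T := Tint U ueq r0 in
  let dom := branch_domain U ueq B r0 in
  (* (1) *)
  [/\ [/\ first_integral_on U phase_space L,
          first_integral_on U phase_space E,
          (forall (J : set R) (r th : R -> R), solution U J r th ->
             forall t1 t2 : R, J t1 -> J t2 ->
               L (state r th t1) = L (state r th t2) /\
               E (state r th t1) = E (state r th t2)),
          (forall p q : phase R, angvel p = angvel q -> rcoord p = rcoord q -> L p = L q)
        & (forall p, E p = 2^-1 * vel p ^+ 2 + Ueff U ueq (L p) (rcoord p))],
  (* (2) *)
      [/\ (forall p, dom p ->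
             [/\ (forall s : R,
                    Num.min (base_radius U ueq r0 p) (rcoord p) < s ->
                    s < Num.max (base_radius U ueq r0 p) (rcoord p) ->
                    0 < angle_radicand U ueq (L p) (E p) s /\
                    0 < time_radicand U ueq (L p) (E p) s),
                 integrable_between (base_radius U ueq r0 p) (rcoord p)
                   (angle_integrand U ueq p)
               & integrable_between (base_radius U ueq r0 p) (rcoord p)
                   (time_integrand U ueq p)]),
          first_integral_on U dom Th,
          first_integral_on U dom T,
          (forall (J : set R) (r th : R -> R),
             solution U J r th -> ~ circular J r ->
             (exists t0 : R, [/\ J t0,
                B (L (state r th t0), E (state r th t0))
              & r t0 = r0 (L (state r th t0), E (state r th t0))]) ->
             forall t1 t2 : R, J t1 -> J t2 -> t1 <= t2 ->
               (forall t : R, t1 <= t <= t2 -> vel (state r th t) != 0) ->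
               Th (state r th t1) = Th (state r th t2) /\
               T (state r th t1) = T (state r th t2))
        & (forall p, dom p ->
             Th p = angle p - L p *
               oriented_integral (base_radius U ueq r0 p) (rcoord p)
                 (fun s => Num.sg (vel p) /
                    (s ^+ 2 * Num.sqrt (2 * (E p - Ueff U ueq (L p) s)))) /\
             T p = time p -
               oriented_integral (base_radius U ueq r0 p) (rcoord p)
                 (fun s => Num.sg (vel p) /
                    Num.sqrt (2 * (E p - Ueff U ueq (L p) s))))],
  (* (3) *)
      [/\ constant_of_motion_on U phase_space L,
          constant_of_motion_on U phase_space E,
          constant_of_motion_on U dom Th
        & forall p, dom p ->
            functionally_independent_at (tnth [tuple L; E; Th]) p]
  (* (4) *)
    & forall (D : set (phase R)) (I : phase R -> R),
        open D -> D `<=` phase_space ->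
        (first_integral_on U D I -> forall p, D p -> dom p ->
           locally_function_of (fun q => (L q, E q, Th q, T q)) I p) /\
        (constant_of_motion_on U D I -> forall p, D p -> dom p ->
           locally_function_of (fun q => (L q, E q, Th q)) I p)].
Proof.
move=> L E Th T dom.
have hL := first_integral_angmom U; have hE := first_integral_energy ueq hU.
have hTh := first_integral_Theta hU hr0; have hT := first_integral_Tint hU hr0.
split.
- split=> //.
  + by move=> J r th sol t1 t2 J1 J2; exact: (conserved_along_solution ueq hU sol J1 J2).
  + by move=> p q; rewrite /L /angmom => -> ->.
  + by move=> p; rewrite /E /energy /Ueff !addrA.
- split; [|exact: hTh|exact: hT| |].
  + move=> p dp; have [rp _ Yx _] := branch_domain_radicand hU hr0 dp.
    have [_ Bp _] := dp; have [_ r0p _] := branch_radius hU hr0 Bp.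
    have [G0 [G2 [oi0 oi2 _ _]]] := local_formulas hU hr0 dp.
    split; [|exact: (angle_integrand_is r0p rp oi2).1|exact: (time_integrand_is oi0).1].
    move=> s h1 h2; have Ys : 0 < radicand U ueq (L p, E p, s) by apply: Yx; rewrite h1.
    have s0 : 0 < s by apply: lt_trans h1; rewrite lt_min r0p.
    split; last exact: Ys.
    by rewrite angle_radicandE// mulr_gt0// exprn_gt0.
  + move=> J r th sol _ [t0 [J0 B0 r0E]] t1 t2 J1 J2 t12 v0.
    (* The given solution itself witnesses that the trajectory of each of its states passes through
       r0: L and E are conserved, so r0(L, E) is the radius reached at t0. *)
    have domt t : Num.min t1 t2 <= t <= Num.max t1 t2 -> dom (state r th t).
      rewrite (min_idPl t12) (max_idPr t12) => tI.
      have Jt : J t by have [_ iJ _] := sol; exact: iJ tI.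
      have [Lt Et] := conserved_along_solution ueq hU sol J0 Jt.
      split; first exact: v0.
      * by rewrite -Lt -Et.
      * by exists J, r, th, t, t0; split=> //; rewrite /base_radius -Lt -Et.
    by split; [exact: (first_integral_along_solution sol hTh)
              |exact: (first_integral_along_solution sol hT)].
  + move=> p dp; have [rp _ _ _] := branch_domain_radicand hU hr0 dp.
    have [_ Bp _] := dp; have [_ r0p _] := branch_radius hU hr0 Bp.
    have [G0 [G2 [oi0 oi2 _ _]]] := local_formulas hU hr0 dp.
    have a1 := angle_integrand_is r0p rp oi2; have t1 := time_integrand_is oi0.
    split; rewrite /Th /T /Theta /Tint.
    * congr (_ - _ * _); rewrite a1.2; apply/esym; apply: (proj2 (eq_oint _ a1)).
      move=> x /andP[xm _]; have x0 : 0 < x by apply: lt_le_trans xm; rewrite lt_min r0p.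
      by rewrite /angle_integrand sqrt_angle_radicand// radicand_Ueff.
    * congr (_ - _); rewrite t1.2; apply/esym; apply: (proj2 (eq_oint _ t1)).
      by move=> x _; rewrite -radicand_Ueff.
- split.
  + by split; [exact: hL|move=> t t' r th v w _ _].
  + by split; [exact: hE|move=> t t' r th v w _ _].
  + by split; [exact: hTh|move=> t t' r th v w _ _].
  + by move=> p dp; exact: (functionally_independent_LETh hU hr0 dp).
- move=> D I oD _; split.
  + by move=> fI p Dp dp; exact: (first_integral_function hU hr0 oD fI Dp dp).
  + by move=> cI p Dp dp; exact: (constant_of_motion_function hU hr0 oD cI Dp dp).
Qed.
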